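(* Let $\tau_1,\dots,\tau_m,\omega$ be ordered trees. The product $$\tau_1\cdots\tau_m\blacktriangleright\omega=\sum_{w\in S_m}[\tau_1,\dots,\tau_m;\omega]_w$$ is equal to the sum of all left graftings with rootstock $\omega$ and then scions $\tau_1,\dots,\tau_m$ grafted in any order, but under the constraint that $\tau_i$ is to the left of $\tau_j$ for any $i>j$ whenever they are attached to the same node. Explicitly, the sum is over all ways of assigning to each $i\in\{1,\dots,m\}$ a node $s_i$ of $\omega$ or of some $\tau_j$ with $j\neq i$, such that attaching the root of each $\tau_i$ by a new edge to $s_i$ yields a tree containing $\omega,\tau_1,\dots,\tau_m$ whose root is the root of $\omega$; the term for such an assignment is the resulting ordered tree, where at each node the attached scions are placed to the left of the original children of that node, and among the scions attached to the same node those with larger index are further to the left.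
   Context: $\mathbf k$ is an algebraically closed field of characteristic $0$. Let $\mathcal{OT}$ be the set of isomorphism classes of ordered (planar rooted) trees, and $\mathcal{OF}$ the set of ordered forests, i.e. finite words $\tau_1\cdots\tau_m$ of ordered trees, with the empty forest denoted $1$. $\mathbf k\{\mathcal{OT}\}$ is the vector space with basis $\mathcal{OT}$, and $\mathbf k\{\mathcal{OF}\}=\mathsf T(\mathbf k\{\mathcal{OT}\})$ is its tensor algebra (product: concatenation). Left grafting: $\tau\curvearrowright\omega=\sum_{s\in\mathrm{Nodes}(\omega)}\tau\curvearrowright_s\omega$, where $\tau\curvearrowright_s\omega$ is the ordered tree obtained by attaching the root of $\tau$ by a new edge to the node $s$ of $\omega$ as its leftmost child; extended bilinearly. Equip $\mathbf k\{\mathcal{OF}\}$ with the coshuffle coproduct $\Delta$ (the algebra map with $\Delta(\tau)=\tau\otimes1+1\otimes\tau$ for $\tau\in\mathcal{OT}$; Sweedler notation $X_1\otimes X_2$, iterated coproduct $X_1\otimes\cdots\otimes X_k$) and counit $\varepsilon$. Extend $\curvearrowright$ to a product $\rhd$ on $\mathbf k\{\mathcal{OF}\}$ by: $\tau\rhd\omega=\tau\curvearrowright\omega$ for trees; $1\rhd\omega=\omega$; $(\tau\tau_1\cdots\tau_n)\rhd\omega=\tau\rhd\big((\tau_1\cdots\tau_n)\rhd\omega\big)-\sum_{i=1}^n\big(\tau_1\cdots\tau_{i-1}(\tau\curvearrowright\tau_i)\tau_{i+1}\cdots\tau_n\big)\rhd\omega$; $X\rhd1=\varepsilon(X)1$;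 $X\rhd(\omega_1\cdots\omega_k)=(X_1\rhd\omega_1)\cdots(X_k\rhd\omega_k)$. With $X\circ Y=X_1(X_2\rhd Y)$, $(\mathbf k\{\mathcal{OF}\},\circ,1,\Delta,\varepsilon)$ is a Hopf algebra (known); denote its antipode by $S_\rhd$. Then $X\blacktriangleright Y:=(-1)^{|X|}S_\rhd(X)\rhd Y$ for forests $X,Y$, where $|X|$ is the number of trees in $X$. Definition of $[\tau_1,\dots,\tau_m;\omega]_w$ for $w\in S_m$: start with the sequence $\tau_{w(1)},\dots,\tau_{w(m)},\omega$. For $k=1,\dots,m$ successively, take the entry of the current sequence which involves $\tau_k$ (treating $\tau_1,\dots,\tau_m$ as formal symbols), call it $A$, and let $C$ be the entry immediately to its right; replace the two adjacent entries $A,C$ by the single entry $A\curvearrowright C$. After $m$ steps one entry remains, and it is $[\tau_1,\dots,\tau_m;\omega]_w$. *)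

(* Defs.v *)
From HB Require Import structures.
From mathcomp Require Import all_boot all_order all_algebra all_fingroup.
From mathcomp Require Export finmap monalg.

Set Implicit Arguments.
Unset Strict Implicit.
Unset Printing Implicit Defensive.

Import GRing.Theory.

Local Open Scope ring_scope.

(* {malg k[T]} is the free k-module on the basis T, and << x >> the basis
   element x.  {fmonom T} is the free monoid of words over T, so that
   {malg k[{fmonom T}]} is the tensor algebra of {malg k[T]}. *)

(* -------------------------------------------------------------------- *)
Inductive tree : Type := Node of seq tree.

Definition children (t : tree) : seq tree := let: Node ts := t in ts.

Definition leaf : tree := Node [::].

Fixpoint tree_encode (t : tree) : GenTree.tree unit :=
  let: Node ts := t in GenTree.Node 0 (map tree_encode ts).

Fixpoint tree_decode (g : GenTree.tree unit) : tree :=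
  if g is GenTree.Node _ gs then Node (map tree_decode gs) else leaf.

Lemma tree_encodeK : cancel tree_encode tree_decode.
Proof.
rewrite /cancel; fix IH 1; case=> ts /=; congr Node; rewrite -map_comp.
by elim: ts => //= t ts ->; rewrite IH.
Qed.

HB.instance Definition _ := Choice.copy tree (can_type tree_encodeK).

(* A node is given by its address: the word of child indices (from 0, left
   to right) leading to it from the root. *)
Fixpoint nodes (t : tree) : seq (seq nat) :=
  let: Node ts := t in
  let fix below i us :=
    if us is u :: us' then map (cons i) (nodes u) ++ below i.+1 us'
    else [::] in
  [::] :: below 0%N ts.

Fixpoint subtree (t : tree) (a : seq nat) : tree :=
  if a is i :: a' then subtree (nth leaf (children t) i) a' else t.

Fixpoint graft_at (t w : tree) (a : seq nat) : tree :=
  if a is i :: a' then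
    Node (set_nth leaf (children w) i
            (graft_at t (nth leaf (children w) i) a'))
  else Node (t :: children w).

(* -------------------------------------------------------------------- *)
Section PairMonom.
Variables M N : monomType.
Implicit Types x y z : M * N.

Definition pmone : M * N := (mone, mone).
Definition pmmul x y : M * N := (mmul x.1 y.1, mmul x.2 y.2).

Fact pmmulA : associative pmmul.
Proof. by move=> x y z; rewrite /pmmul !mulmA. Qed.
Fact pmmul1m : left_id pmone pmmul.
Proof. by case=> x y; rewrite /pmmul /= !mul1m. Qed.
Fact pmmulm1 : right_id pmone pmmul.
Proof. by case=> x y; rewrite /pmmul /= !mulm1. Qed.
Fact pmmul_eq1 x y : pmmul x y = pmone -> x = pmone /\ y = pmone.
Proof.
by case: x y => [a b] [c d] [/unitm[/= -> ->] /unitm[/= -> ->]].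
Qed.

HB.instance Definition _ :=
  Choice_isMonomialDef.Build (M * N)%type pmmulA pmmul1m pmmulm1 pmmul_eq1.

Lemma pmmulE (a c : M) (b d : N) :
  mmul (a, b) (c, d) = (mmul a c, mmul b d) :> M * N.
Proof. by []. Qed.
End PairMonom.

(* -------------------------------------------------------------------- *)
Section LinExt.
Variables (k : fieldType) (T : choiceType) (V : lmodType k).

Definition linext (f : T -> V) (x : {malg k[T]}) : V :=
  \sum_(u <- msupp x) x@_u *: f u.

Lemma linextEw f x (d : {fset T}) :
  {subset msupp x <= d} -> linext f x = \sum_(u <- d) x@_u *: f u.
Proof.
move=> sd; rewrite /linext; apply: big_fset_incl; first exact/fsubsetP.
by move=> u _ /mcoeff_outdom ->; rewrite scale0r.
Qed.

Lemma linext_is_linear f : linear (linext f).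
Proof.
move=> c x y; pose d := (msupp x `|` msupp y)%fset.
have sx : {subset msupp x <= d} by apply/fsubsetP/fsubsetUl.
have sy : {subset msupp y <= d} by apply/fsubsetP/fsubsetUr.
have sxy : {subset msupp (c *: x + y) <= d}.
  move=> u; rewrite -!mcoeff_neq0 mcoeffD mcoeffZ => h.
  rewrite in_fsetU -!mcoeff_neq0; apply: contraR h.
  by rewrite negb_or !negbK => /andP[/eqP -> /eqP ->]; rewrite mulr0 addr0.
rewrite (linextEw f sxy) (linextEw f sx) (linextEw f sy).
rewrite scaler_sumr -big_split; apply: eq_bigr => u _ /=.
by rewrite mcoeffD mcoeffZ scalerDl scalerA.
Qed.

HB.instance Definition _ f :=
  GRing.isLinear.Build k {malg k[T]} V *:%R (linext f) (linext_is_linear f).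

Lemma linextD f x y : linext f (x + y) = linext f x + linext f y.
Proof. exact: linearD. Qed.

Lemma linextB f x y : linext f (x - y) = linext f x - linext f y.
Proof. exact: linearB. Qed.

Lemma linextZ f c x : linext f (c *: x) = c *: linext f x.
Proof. exact: linearZ. Qed.

Lemma linext_sum f (I : Type) (r : seq I) (P : pred I) (F : I -> {malg k[T]}) :
  linext f (\sum_(i <- r | P i) F i) = \sum_(i <- r | P i) linext f (F i).
Proof. exact: linear_sum. Qed.

Lemma linextU f u : linext f << u >> = f u.
Proof.
by rewrite /linext msuppU oner_eq0 big_seq_fset1 mcoeffUU scale1r.
Qed.

Lemma malgUZ (c : k) (u : T) : << c *g u >> = c *: << u >> :> {malg k[T]}.
Proof.
by apply/malgP=> v; rewrite mcoeffZ !mcoeffU mulrnAr mulr1.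
Qed.

Lemma malg_sumU (x : {malg k[T]}) : x = \sum_(u <- msupp x) x@_u *: << u >>.
Proof. by rewrite {1}[x]monalgE; apply: eq_bigr => u _; exact: malgUZ. Qed.

End LinExt.

Lemma malgUM (k : fieldType) (M : monomType) (u v : M) :
  << u >> * << v >> = << mmul u v >> :> {malg k[M]}.
Proof. by rewrite malgM_def fgmulUU mulr1. Qed.

Lemma malg_scaleAr (k : fieldType) (M : monomType) (c : k)
    (x y : {malg k[M]}) : x * (c *: y) = c *: (x * y).
Proof.
rewrite [x]malg_sumU [y]malg_sumU scaler_sumr !mulr_suml scaler_sumr.
apply: eq_bigr => u _; rewrite !mulr_sumr scaler_sumr; apply: eq_bigr => v _.
rewrite scalerA -!malgUZ !malgM_def !fgmulUU malgUZ [in RHS]malgUZ scalerA.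
by rewrite mulrCA.
Qed.

Lemma linext_mulU (k : fieldType) (M : monomType) (V : lmodType k)
    (f : M -> V) (u : M) (y : {malg k[M]}) :
  linext f (<< u >> * y) = linext (fun p => f (mmul u p)) y.
Proof.
rewrite [y]malg_sumU mulr_sumr !linext_sum; apply: eq_bigr => p _ /=.
by rewrite malg_scaleAr !linextZ /= malgUM !linextU.
Qed.

(* -------------------------------------------------------------------- *)
Notation forest := {fmonom tree}.
Notation kOT k := {malg k[tree]}.
Notation kOF k := {malg k[forest]}.
(* Basis pairs (X, Y) stand for X (x) Y, with the componentwise product. *)
Notation kOF2 k := {malg k[(forest * forest)%type]}.

Section GuinOudom.
Variable k : fieldType.

Definition tree_forest (t : tree) : forest := FMonom [:: t].

(* The inclusion of k{OT} in its tensor algebra. *)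
Definition inT : kOT k -> kOF k := linext (fun t => << tree_forest t >>).

Definition graft1 (t w : tree) : kOT k :=
  \sum_(a <- nodes w) << graft_at t w a >>.

Definition graft (x y : kOT k) : kOT k :=
  linext (fun t => linext (graft1 t) y) x.

Definition coprod1 (X : forest) : kOF2 k :=
  \prod_(t <- X) (<< (tree_forest t, mone) >> + << (mone, tree_forest t) >>).

Definition coprod : kOF k -> kOF2 k := linext coprod1.

Definition counit (x : kOF k) : k := x@_(mone : forest).

(* X |> w for a word X and a tree w.  The recursion lowers the length of X,
   so n is always instantiated with size X. *)
Fixpoint rhd_rec (n : nat) (X : seq tree) (w : tree) : kOT k :=
  match n, X with
  | n'.+1, t :: X' =>
      linext (graft1 t) (rhd_rec n' X' w)
      - \sum_(i < size X')
          linext (fun u => rhd_rec n' (set_nth leaf X' i u) w)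
                 (graft1 t (nth leaf X' i))
  | _, _ => << w >>
  end.

Definition rhd_tree (X : seq tree) (w : tree) : kOT k :=
  rhd_rec (size X) X w.

(* The Sweedler components of X are distributed one letter of Y at a time. *)
Fixpoint rhd_word (X : forest) (Y : seq tree) : kOF k :=
  if Y is w :: Y' then
    linext (fun p : forest * forest =>
              inT (rhd_tree p.1 w) * rhd_word p.2 Y') (coprod1 X)
  else counit << X >> *: 1.

Definition rhd (x y : kOF k) : kOF k :=
  linext (fun X : forest => linext (fun Y : forest => rhd_word X Y) y) x.

Definition circ (x y : kOF k) : kOF k :=
  linext (fun p : forest * forest => << p.1 >> * rhd << p.2 >> y) (coprod x).

Definition is_antipode (S : {linear kOF k -> kOF k}) : Prop :=
  forall x : kOF k,
    linext (fun p : forest * forest => circ (S << p.1 >>) << p.2 >>)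
           (coprod x) = counit x *: 1
    /\ linext (fun p : forest * forest => circ << p.1 >> (S << p.2 >>))
              (coprod x) = counit x *: 1.

Definition brhd (S : {linear kOF k -> kOF k}) (X Y : forest) : kOF k :=
  (-1) ^+ size X *: rhd (S << X >>) << Y >>.

Lemma rhdUU (X Y : forest) : rhd << X >> << Y >> = rhd_word X Y.
Proof. by rewrite /rhd !linextU. Qed.

Lemma counitU (X : forest) : counit << X >> = (X == mone)%:R.
Proof. by rewrite /counit mcoeffU1. Qed.

Lemma fm_cons t (X : seq tree) :
  FMonom (t :: X) = mmul (tree_forest t) (FMonom X).
Proof. by rewrite /mmul /= fmmulE. Qed.

Lemma coprod1_tree t :
  coprod1 (tree_forest t) =
  << (tree_forest t, mone) >> + << (mone, tree_forest t) >>.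
Proof. by rewrite /coprod1 big_seq1. Qed.

Lemma coprod1M (X Y : forest) : coprod1 (mmul X Y) = coprod1 X * coprod1 Y.
Proof. by rewrite /coprod1 fmM big_cat. Qed.

Lemma linext_coprod1_cons (V : lmodType k) (f : forest * forest -> V) t X :
  linext f (coprod1 (FMonom (t :: X))) =
    linext (fun p => f (mmul (tree_forest t) p.1, p.2)) (coprod1 (FMonom X))
  + linext (fun p => f (p.1, mmul (tree_forest t) p.2)) (coprod1 (FMonom X)).
Proof.
rewrite fm_cons coprod1M coprod1_tree mulrDl linextD.
congr (_ + _); rewrite [LHS]linext_mulU /linext; apply: eq_bigr => -[a b] _;
  by rewrite pmmulE mul1m.
Qed.

Lemma linext_coprod1_counit (V : lmodType k) (f : forest -> V) X :
  linext (fun p => counit << p.2 >> *: f p.1) (coprod1 X) = f X.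
Proof.
case: X => X; elim: X f => [|t X IH] f.
  rewrite /coprod1 /= big_nil.
  have -> : 1 = << (mone, mone) >> :> kOF2 k by [].
  by rewrite linextU /= counitU eqxx scale1r /mone /= fmoneE.
rewrite linext_coprod1_cons /= (IH (fun Y => f (mmul (tree_forest t) Y))).
rewrite [X in _ + X]big1 ?addr0 ?fm_cons // => p _.
rewrite counitU; case: eqP => [/unitm[]|_]; last by rewrite scale0r scaler0.
by move/(congr1 (fun Z : forest => size Z)); rewrite fm1.
Qed.

Lemma rhd_word_tree (X : forest) w :
  rhd << X >> << tree_forest w >> = inT (rhd_tree X w).
Proof.
rewrite rhdUU /=.
rewrite -(linext_coprod1_counit (fun X : forest => inT (rhd_tree X w)) X).
by rewrite /linext; apply: eq_bigr => p _; rewrite malg_scaleAr mulr1.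
Qed.

Lemma rhd_graft t w :
  rhd << tree_forest t >> << tree_forest w >> = inT (graft << t >> << w >>).
Proof.
by rewrite rhd_word_tree /rhd_tree /= big_ord0 subr0 /graft !linextU.
Qed.

Lemma rhd1_tree w : rhd 1 << tree_forest w >> = << tree_forest w >>.
Proof.
have -> : 1 = << mone >> :> kOF k by [].
by rewrite rhd_word_tree /rhd_tree fm1 /= /inT linextU.
Qed.

Lemma rhd_inTr (X : forest) (y : kOT k) :
  rhd << X >> (inT y) = inT (linext (rhd_tree X) y).
Proof.
rewrite [in LHS](malg_sumU y) [in RHS]/linext /inT !linext_sum.
rewrite /rhd linextU linext_sum; apply: eq_bigr => u _.
rewrite !linextZ.
congr (_ *: _).
by rewrite !linextU -rhdUU rhd_word_tree.
Qed.

Lemma rhdZl (c : k) (x y : kOF k) : rhd (c *: x) y = c *: rhd x y.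
Proof. exact: linextZ. Qed.

Lemma rhd_suml (y : kOF k) (I : Type) (r : seq I) (P : pred I)
    (F : I -> kOF k) :
  rhd (\sum_(i <- r | P i) F i) y = \sum_(i <- r | P i) rhd (F i) y.
Proof. exact: linext_sum. Qed.

Lemma rhd_inTl (A B : forest) (y : kOT k) w :
  rhd (<< A >> * inT y * << B >>) << tree_forest w >> =
  inT (linext (fun u => rhd_tree (A ++ u :: B) w) y).
Proof.
rewrite [in LHS](malg_sumU y) [in RHS]/linext.
rewrite /inT !linext_sum mulr_sumr mulr_suml rhd_suml.
apply: eq_bigr => u _.
rewrite !linextZ malg_scaleAr -scalerAl rhdZl.
congr (_ *: _).
rewrite !linextU !malgUM.
rewrite -[RHS](rhd_word_tree (FMonom (A ++ u :: B))).
by congr (rhd << _ >> _); rewrite /mmul /= !fmmulE /= -catA.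
Qed.

Lemma rhd_tree_cons t (X : seq tree) w :
  rhd_tree (t :: X) w =
    linext (graft1 t) (rhd_tree X w)
  - \sum_(i < size X)
      linext (fun u => rhd_tree (take i X ++ u :: drop i.+1 X) w)
             (graft1 t (nth leaf X i)).
Proof.
rewrite {1}/rhd_tree [LHS]/=; congr (_ - _); apply: eq_bigr => i _.
rewrite /linext; apply: eq_bigr => u _; congr (_ *: _).
rewrite set_nthE ltn_ord /rhd_tree.
have -> // : size (take i X ++ u :: drop i.+1 X) = size X.
by rewrite size_cat /= size_take size_drop ltn_ord -subSn // subnKC // ltnW.
Qed.

Lemma rhd_cons t (X : seq tree) w :
  rhd << FMonom (t :: X) >> << tree_forest w >> =
    rhd << tree_forest t >> (rhd << FMonom X >> << tree_forest w >>)
  - \sum_(i < size X)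
      rhd (<< FMonom (take i X) >>
           * inT (graft << t >> << nth leaf X i >>)
           * << FMonom (drop i.+1 X) >>) << tree_forest w >>.
Proof.
have E u : rhd_tree (tree_forest t) u = graft1 t u.
  by rewrite /rhd_tree /= big_ord0 subr0 linextU.
transitivity (inT (rhd_tree (t :: X) w)); first exact: rhd_word_tree.
rewrite rhd_tree_cons [LHS]linextB [X in _ - X = _]linext_sum; congr (_ - _).
  have -> : rhd << FMonom X >> << tree_forest w >> = inT (rhd_tree X w).
    exact: rhd_word_tree.
  rewrite rhd_inTr /inT; congr (linext _ _).
  by apply: eq_bigr => u _; rewrite E.
by apply: eq_bigr => i _; rewrite rhd_inTl /graft !linextU.
Qed.

Lemma rhd_unit (X : forest) : rhd << X >> 1 = counit << X >> *: 1.
Proof. by have -> : 1 = << mone >> :> kOF k by []; rewrite rhdUU fm1. Qed.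

Lemma rhd_split (X : forest) w (Y : seq tree) :
  rhd << X >> << FMonom (w :: Y) >> =
  linext (fun p : forest * forest =>
            rhd << p.1 >> << tree_forest w >> * rhd << p.2 >> << FMonom Y >>)
         (coprod << X >>).
Proof.
rewrite rhdUU /coprod linextU /= /linext; apply: eq_bigr => p _.
by rewrite rhd_word_tree rhdUU.
Qed.

End GuinOudom.

(* -------------------------------------------------------------------- *)
(* Formal bracketings in the symbols tau_i (Some i) and omega (None). *)
Inductive gexpr (m : nat) : Type :=
  | Sym of option 'I_m
  | Gr of gexpr m & gexpr m.

Arguments Sym {m}.
Arguments Gr {m}.

Section Bracket.
Variables (k : fieldType) (m : nat) (t : m.-tuple tree) (w : tree).

Definition comp (c : option 'I_m) : tree := oapp (tnth t) w c.

Fixpoint involves (i : 'I_m) (e : gexpr m) : bool :=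
  match e with
  | Sym c => c == Some i
  | Gr e1 e2 => involves i e1 || involves i e2
  end.

Fixpoint merge_at (i : 'I_m) (s : seq (gexpr m)) : seq (gexpr m) :=
  match s with
  | A :: ((C :: s') as r) =>
      if involves i A then Gr A C :: s' else A :: merge_at i r
  | _ => s
  end.

Fixpoint geval (e : gexpr m) : kOT k :=
  match e with
  | Sym c => << comp c >>
  | Gr e1 e2 => graft (geval e1) (geval e2)
  end.

Definition bracket_seq (p : 'S_m) : seq (gexpr m) :=
  rcons [seq Sym (Some (p i)) | i <- enum 'I_m] (Sym None).

(* Each entry contains exactly one symbol among omega and the tau_j not yet
   processed, so merge_at always finds a right neighbour, and exactly one entry
   remains after m steps: the default value of head is not used. *)
Definition bracket (p : 'S_m) : kOT k :=
  geval (head (Sym None)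
    (foldl (fun s i => merge_at i s) (bracket_seq p) (enum 'I_m))).

End Bracket.

(* -------------------------------------------------------------------- *)
Section Graftings.
Variables (m : nat) (t : m.-tuple tree) (w : tree).

(* (c, a) is the node with address a in the tree comp t w c. *)
Definition gnode := (option 'I_m * seq nat)%type.

Definition gnodes : seq gnode :=
  [seq (c, a) | c <- enum {: option 'I_m}, a <- nodes (comp t w c)].

Definition groot : gnode := (None, [::]).

Definition assignment := {ffun 'I_m -> seq_sub gnodes}.

Implicit Type s : assignment.

Definition target s (i : 'I_m) : gnode := ssval (s i).

Definition gparent s (v : gnode) : gnode :=
  if v.2 is _ :: _ then (v.1, take (size v.2).-1 v.2)
  else if v.1 is Some i then target s i
  else groot.

(* The graph obtained by attaching is a tree rooted at the root of omega:
   every node reaches that root, which gparent fixes, by climbing edges. *)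
Definition is_grafting s : bool :=
  [forall i, (target s i).1 != Some i] &&
  all (fun v => iter (size gnodes) (gparent s) v == groot) gnodes.

Definition gchildren s (v : gnode) : seq gnode :=
  [seq (Some i, [::]) | i <- rev (enum 'I_m) & target s i == v]
  ++ [seq (v.1, rcons v.2 j)
     | j <- iota 0 (size (children (subtree (comp t w v.1) v.2)))].

(* Truncation at depth n.  When s is a grafting, it loses nothing for n the
   number of nodes, which exceeds the depth of the resulting tree. *)
Fixpoint unfold_tree s (n : nat) (v : gnode) : tree :=
  if n is n'.+1 then Node (map (unfold_tree s n') (gchildren s v)) else leaf.

Definition grafting s : tree := unfold_tree s (size gnodes) groot.

End Graftings.

(* Main.v *)
Require Import Defs.
From mathcomp Require Import all_boot all_order all_algebra all_fingroup.
From mathcomp Require Import finmap monalg.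

Set Implicit Arguments.
Unset Strict Implicit.
Unset Printing Implicit Defensive.

Import GRing.Theory.

Local Open Scope ring_scope.

(* Write B(X; w) for the sum over the permutations.  Merging tau_1 with its
   right neighbour shows that
     B(tau X; w) = B(X; tau grafted on w) + sum_j B(X with tau grafted on tau_j; w).

   The antipode S satisfies S(X_1) |> (X_2 |> w) = eps(X) w, because
   (X o Y) |> w = X |> (Y |> w), and by its recursion X |-> (-1)^|X| B(X; -)
   satisfies the same equation in place of S(X) |> -.  The solution is unique by
   induction on |X|, so S(X) |> w = (-1)^|X| B(X; w).

   For the sum over assignments, give the nodes of w and of the tau_i labels that
   grafting does not change.  The recursion chooses for tau_1, tau_2, ... in turn
   a label outside of the tree to be grafted, and an assignment can be chosen in
   this way exactly when it has no cycle. *)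

(** * The antipode *)

(** The terms of the coshuffle coproduct of a word, as pairs of complementary subwords counted with
    multiplicity. *)
Fixpoint splits (X : seq tree) : seq (seq tree * seq tree) :=
  if X is t :: X' then
    [seq (t :: p.1, p.2) | p <- splits X'] ++ [seq (p.1, t :: p.2) | p <- splits X']
  else [:: ([::], [::])].

Definition grafts (t w : tree) : seq tree := [seq graft_at t w a | a <- nodes w].

(** The terms of t |> X, where t acts on a word by the Leibniz rule. *)
Fixpoint word_grafts (t : tree) (X : seq tree) : seq (seq tree) :=
  if X is x :: X' then
    [seq u :: X' | u <- grafts t x] ++ [seq x :: Y | Y <- word_grafts t X']
  else [::].

Lemma size_word_grafts t X Y : Y \in word_grafts t X -> size Y = size X.
Proof.
elim: X Y => //= x X IH Y; rewrite mem_cat => /orP[] /mapP[Z].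
  by move=> _ ->.
by move=> /IH <- ->.
Qed.

Section Splits.
Variable V : zmodType.

Lemma big_splits_cons (f : seq tree * seq tree -> V) t X :
  \sum_(p <- splits (t :: X)) f p =
  \sum_(p <- splits X) f (t :: p.1, p.2) + \sum_(p <- splits X) f (p.1, t :: p.2).
Proof. by rewrite /= big_cat !big_map. Qed.

Lemma big_word_grafts_cons (f : seq tree -> V) t x X :
  \sum_(Y <- word_grafts t (x :: X)) f Y =
  \sum_(u <- grafts t x) f (u :: X) + \sum_(Y <- word_grafts t X) f (x :: Y).
Proof. by rewrite /= big_cat !big_map. Qed.

Lemma size_splits X p : p \in splits X -> (size p.1 + size p.2)%N = size X.
Proof.
elim: X p => [|t X IH] p /=; first by rewrite inE => /eqP ->.
by rewrite mem_cat => /orP[] /mapP[q /IH <- ->]; rewrite ?addnS.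
Qed.

Lemma big_splits_nil_r (f : seq tree * seq tree -> V) X :
  \sum_(p <- splits X | p.2 == [::]) f p = f (X, [::]).
Proof.
elim: X f => [|t X IH] f /=; first by rewrite big_mkcond big_seq1.
rewrite big_cat !big_map /= (IH (fun p => f (t :: p.1, p.2))).
by rewrite big_pred0 ?addr0.
Qed.

(** The letter of [X] that receives [t] lies in exactly one of the two subwords: grafting [t] is a
    coderivation of the coshuffle coproduct. *)
Lemma splits_word_grafts (g : seq tree * seq tree -> V) t X :
  \sum_(Y <- word_grafts t X) \sum_(p <- splits Y) g p =
  \sum_(p <- splits X) (\sum_(Y <- word_grafts t p.1) g (Y, p.2)
                        + \sum_(Y <- word_grafts t p.2) g (p.1, Y)).
Proof.
elim: X g => [|x X IH] g; first by rewrite big_nil big_seq1 /= !big_nil addr0.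
rewrite big_word_grafts_cons big_splits_cons.
under eq_bigr do rewrite big_splits_cons.
under [X in _ + X = _]eq_bigr do rewrite big_splits_cons.
under [X in _ = X + _]eq_bigr do rewrite big_word_grafts_cons.
under [X in _ = _ + X]eq_bigr do rewrite big_word_grafts_cons.
rewrite !big_split /= (IH (fun p => g (x :: p.1, p.2))).
rewrite (IH (fun p => g (p.1, x :: p.2))) /= !big_split /=.
rewrite [X in _ = X + _ + _ + _]exchange_big [X in _ = _ + (_ + (X + _))]exchange_big.
by rewrite -!addrA /=; congr (_ + _); do 2![rewrite addrCA; congr (_ + _)]; rewrite addrCA.
Qed.
End Splits.

Section Antipode.
Variable k : fieldType.

Lemma linext_eq (T : choiceType) (V : lmodType k) (f g : T -> V) :
  f =1 g -> linext f =1 linext g.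
Proof. by move=> e x; rewrite /linext; apply: eq_bigr => u _; rewrite e. Qed.

Lemma linext_subsum (T : choiceType) (V : lmodType k) (I : Type) (r : seq I)
    (f : T -> V) (F : I -> T -> V) (x : {malg k[T]}) :
  linext (fun u => f u - \sum_(i <- r) F i u) x =
  linext f x - \sum_(i <- r) linext (F i) x.
Proof.
rewrite /linext exchange_big -sumrB; apply: eq_bigr => u _.
by rewrite scalerBr scaler_sumr.
Qed.

Lemma linext_coprod1 (V : lmodType k) (f : forest * forest -> V) X :
  linext f (coprod1 k (FMonom X)) =
  \sum_(p <- splits X) f (FMonom p.1, FMonom p.2).
Proof.
elim: X f => [|t X IH] f.
  rewrite /coprod1 /= big_nil big_seq1 /=.
  have -> : 1 = << (mone, mone) >> :> kOF2 k by [].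
  by rewrite linextU /mone /= fmoneE.
rewrite linext_coprod1_cons big_splits_cons !IH.
by congr (_ + _); apply: eq_bigr => p _; congr (f (_, _)); rewrite /= fm_cons.
Qed.

Lemma graft1E t w : graft1 k t w = \sum_(u <- grafts t w) << u >>.
Proof. by rewrite big_map. Qed.

Lemma linext_graft1 (V : lmodType k) (f : tree -> V) t w :
  linext f (graft1 k t w) = \sum_(u <- grafts t w) f u.
Proof. by rewrite graft1E linext_sum; under eq_bigr do rewrite linextU. Qed.

Lemma big_word_grafts (V : lmodType k) (f : seq tree -> V) t X :
  \sum_(i < size X) linext (fun u => f (take i X ++ u :: drop i.+1 X))
                           (graft1 k t (nth leaf X i)) =
  \sum_(Y <- word_grafts t X) f Y.
Proof.
elim: X f => [|x X IH] f; first by rewrite big_ord0 big_nil.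
rewrite big_word_grafts_cons big_ord_recl /= linext_graft1 drop0; congr (_ + _).
by rewrite -(IH (fun Y => f (x :: Y))).
Qed.

(** The defining recursion (tX) |> w = t |> (X |> w) - (t |> X) |> w, with the sum over positions
    replaced by a sum over a list of words. *)
Lemma rhd_tree_deriv t X w :
  rhd_tree k (t :: X) w = linext (graft1 k t) (rhd_tree k X w)
    - \sum_(Y <- word_grafts t X) rhd_tree k Y w.
Proof.
by rewrite rhd_tree_cons (big_word_grafts (fun Y => rhd_tree k Y w)).
Qed.

(** The operator t |> - on k{OF}; by [fderivM] it is a derivation for concatenation. *)
Definition fderiv (t : tree) : kOF k -> kOF k :=
  linext (fun Y : forest => \sum_(Z <- word_grafts t Y) << FMonom Z >>).

Lemma fderivU t X : fderiv t << FMonom X >> = \sum_(Z <- word_grafts t X) << FMonom Z >>.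
Proof. by rewrite /fderiv linextU. Qed.

Lemma fderivD t x y : fderiv t (x + y) = fderiv t x + fderiv t y.
Proof. exact: linextD. Qed.

Lemma fderivZ t c x : fderiv t (c *: x) = c *: fderiv t x.
Proof. exact: linextZ. Qed.

Lemma fderiv_sum t (I : Type) (r : seq I) P (F : I -> kOF k) :
  fderiv t (\sum_(i <- r | P i) F i) = \sum_(i <- r | P i) fderiv t (F i).
Proof. exact: linext_sum. Qed.

Lemma inTB x y : inT (x - y) = inT x - inT y :> kOF k.
Proof. exact: linextB. Qed.

Lemma kOF1E : 1 = << FMonom [::] >> :> kOF k.
Proof. by have -> : 1 = << mone >> :> kOF k by []; rewrite /mone /= fmoneE. Qed.

Lemma fderiv1 t : fderiv t 1 = 0.
Proof. by rewrite kOF1E fderivU big_nil. Qed.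

Lemma word_grafts_cat (V : zmodType) (f : seq tree -> V) t X Y :
  \sum_(Z <- word_grafts t (X ++ Y)) f Z =
  \sum_(Z <- word_grafts t X) f (Z ++ Y) + \sum_(Z <- word_grafts t Y) f (X ++ Z).
Proof.
elim: X f => [|x X IH] f; first by rewrite big_nil add0r.
by rewrite cat_cons !big_word_grafts_cons (IH (fun Z => f (x :: Z))) -addrA.
Qed.

Lemma fmulU X Y : << FMonom X >> * << FMonom Y >> = << FMonom (X ++ Y) >> :> kOF k.
Proof. by rewrite malgUM /mmul /= fmmulE. Qed.

Lemma linear_basis (T : choiceType) (V : lmodType k) (f g : {malg k[T]} -> V) :
  linear f -> linear g -> (forall u, f << u >> = g << u >>) -> f =1 g.
Proof.
have lin0 (h : {malg k[T]} -> V) : linear h -> h 0 = 0.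
  by move/(_ (-1) 0 0); rewrite scaler0 addr0 scaleN1r addNr.
move=> fl gl fg x; rewrite [x]malg_sumU; elim/big_rec: _ => [|u z _ Hz].
  by rewrite !lin0.
by rewrite fl gl fg Hz.
Qed.

Lemma derivation_basis (T : choiceType) (D : {malg k[T]} -> {malg k[T]})
    (m : {malg k[T]} -> {malg k[T]} -> {malg k[T]}) :
  linear D -> (forall y, linear (m^~ y)) -> (forall x, linear (m x)) ->
  (forall u v, D (m << u >> << v >>) = m (D << u >>) << v >> + m << u >> (D << v >>)) ->
  forall x y, D (m x y) = m (D x) y + m x (D y).
Proof.
move=> Dl ml mr mU x y.
have lin0 (f : {malg k[T]} -> {malg k[T]}) : linear f -> f 0 = 0.
  by move/(_ (-1) 0 0); rewrite scaler0 addr0 scaleN1r addNr.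
have D0 := lin0 _ Dl; have ml0 z := lin0 _ (ml z); have mr0 z := lin0 _ (mr z).
rewrite [x]malg_sumU; elim/big_rec: _ => [|u z _ Hz].
  by rewrite D0 !ml0 D0 addr0.
rewrite ml !Dl !ml addrACA -scalerDr; apply: (congr2 (fun a b => x@_u *: a + b) _ Hz).
rewrite [y]malg_sumU; elim/big_rec: _ => [|v w _ Hw].
  by rewrite D0 !mr0 D0 addr0.
by rewrite mr !Dl !mr Hw mU addrACA -scalerDr.
Qed.

Lemma fderivM t x y : fderiv t (x * y) = fderiv t x * y + x * fderiv t y.
Proof.
have fU X Y : fderiv t (<< FMonom X >> * << FMonom Y >>) =
    fderiv t << FMonom X >> * << FMonom Y >> + << FMonom X >> * fderiv t << FMonom Y >>.
  rewrite fmulU !fderivU word_grafts_cat mulr_suml mulr_sumr.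
  by congr (_ + _); apply: eq_bigr => Z _; rewrite fmulU.
apply: derivation_basis => [c u v|z c u v|z c u v|[X] [Y]]; last exact: fU.
- by rewrite fderivD fderivZ.
- by rewrite mulrDl scalerAl.
- by rewrite mulrDr malg_scaleAr.
Qed.

Lemma inTZ c x : inT (c *: x) = c *: inT x :> kOF k.
Proof. exact: linextZ. Qed.

Lemma inT_sum (I : Type) (r : seq I) P (F : I -> kOT k) :
  inT (\sum_(i <- r | P i) F i) = \sum_(i <- r | P i) inT (F i).
Proof. exact: linext_sum. Qed.

Lemma inTU t : inT << t >> = << FMonom [:: t] >> :> kOF k.
Proof. by rewrite /inT linextU. Qed.

Lemma fderiv_inT t (x : kOT k) :
  fderiv t (inT x) = inT (linext (graft1 k t) x).
Proof.
rewrite [x]malg_sumU inT_sum /fderiv !linext_sum inT_sum; apply: eq_bigr => u _.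
rewrite inTZ !linextZ inTZ; congr (_ *: _).
rewrite inTU -/(fderiv t _) fderivU linextU graft1E inT_sum big_word_grafts_cons big_nil addr0.
by apply: eq_bigr => v _; rewrite inTU.
Qed.

Lemma rhd_word_cons X w Y :
  rhd_word k (FMonom X) (w :: Y) =
  \sum_(p <- splits X) inT (rhd_tree k p.1 w) * rhd_word k (FMonom p.2) Y.
Proof. by rewrite /= linext_coprod1. Qed.

(** The algebra common to [rhd_word_deriv] and [circ_cons]: if [l'] and [r'] are the derivatives of
    [l] and [r] up to corrections, the corrections distribute over the product in the way that a
    coderivation does. *)
Lemma leibniz_sub (R : pzRingType) (I : Type) (sl sr : seq I) (D : R -> R)
    (l l' r r' : R) (fl fr : I -> R) :
  D (l * r) = D l * r + l * D r ->
  l' = D l - \sum_(i <- sl) fl i -> r' = D r - \sum_(i <- sr) fr i ->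
  l' * r + l * r' = D (l * r) - (\sum_(i <- sl) fl i * r + \sum_(i <- sr) l * fr i).
Proof.
move=> -> -> ->; rewrite mulrBl mulrBr mulr_suml mulr_sumr opprD.
by rewrite addrACA.
Qed.

Lemma counitN X : counit << FMonom X >> = (X == [::])%:R :> k.
Proof. by rewrite counitU /mone /= fmoneE -val_eqE. Qed.

(** Carries the recursion of |> from trees on the right to words on the right. By induction on [Y]:
    in each split of tX the letter t goes left or right, [fderiv] obeys the Leibniz rule, and the
    correction terms regroup by [splits_word_grafts]. *)
Lemma rhd_word_deriv t X Y :
  rhd_word k (FMonom (t :: X)) Y = fderiv t (rhd_word k (FMonom X) Y)
    - \sum_(Z <- word_grafts t X) rhd_word k (FMonom Z) Y.
Proof.
elim: Y t X => [|w Y IH] t X.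
  (* For empty [Y] only counits remain; a grafted word has the length of [X] and exists only if [X]
     is nonempty, so its counit is 0. *)
  rewrite /= !counitN fderivZ fderiv1 scale0r scaler0 sub0r big_seq.
  rewrite big1 ?oppr0 // => Z; case: X => // x X /size_word_grafts; rewrite counitN.
  by case: Z => // z Z _; rewrite scale0r.
under [X in _ - X]eq_bigr do rewrite rhd_word_cons.
rewrite !rhd_word_cons big_splits_cons splits_word_grafts fderiv_sum -big_split.
rewrite -sumrB; apply: eq_bigr => p _ /=.
apply: leibniz_sub; [exact: fderivM | | exact: IH].
by rewrite rhd_tree_deriv inTB inT_sum fderiv_inT.
Qed.

Lemma circU X Y :
  circ << FMonom X >> << FMonom Y >> =
  \sum_(p <- splits X) << FMonom p.1 >> * rhd_word k (FMonom p.2) Y :> kOF k.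
Proof.
rewrite /circ /coprod linextU linext_coprod1; apply: eq_bigr => p _.
by rewrite rhdUU.
Qed.

(** This is (t o X) o Y = t o (X o Y) written out, since t o Z = tZ + t |> Z. In a split of tX, the
    letter t either prefixes the left factor or acts with the right one by [rhd_word_deriv]. *)
Lemma circ_cons t X Y :
  circ << FMonom (t :: X) >> << FMonom Y >> =
    << FMonom [:: t] >> * circ << FMonom X >> << FMonom Y >>
    + fderiv t (circ << FMonom X >> << FMonom Y >>)
    - \sum_(Z <- word_grafts t X) circ << FMonom Z >> << FMonom Y >> :> kOF k.
Proof.
under [X in _ - X]eq_bigr do rewrite circU.
rewrite (circU (t :: X)) (circU X) big_splits_cons splits_word_grafts fderiv_sum.
rewrite -addrA; congr (_ + _).
  rewrite [RHS]mulr_sumr; apply: eq_bigr => p _; rewrite [RHS]mulrA.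
  by congr (_ * _); rewrite fmulU.
rewrite -sumrB; apply: eq_bigr => p _.
(* The left factor enters [leibniz_sub] with [l' = 0]: its derivative is exactly the sum of its
   graftings. *)
set r := rhd_word k (FMonom p.2) Y; have fl : 0 = fderiv t << FMonom p.1 >>
    - \sum_(Z <- word_grafts t p.1) << FMonom Z >> by rewrite fderivU subrr.
have := leibniz_sub (fderivM t << FMonom p.1 >> r) fl (rhd_word_deriv t p.2 Y).
by rewrite mul0r add0r.
Qed.

Lemma rhd_word_nil Y : rhd_word k (FMonom [::]) Y = << FMonom Y >>.
Proof.
elim: Y => [|w Y IH]; first by rewrite /= counitN scale1r kOF1E.
by rewrite rhd_word_cons big_seq1 /= IH inTU fmulU.
Qed.

(** * The action of forests on trees and the uniqueness of its convolution inverse *)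

Definition act (x : kOF k) (w : tree) : kOT k :=
  linext (fun X : forest => rhd_tree k X w) x.

Lemma actU X w : act << FMonom X >> w = rhd_tree k X w.
Proof. by rewrite /act linextU. Qed.

Lemma actD x y w : act (x + y) w = act x w + act y w.
Proof. exact: linextD. Qed.
Lemma actP c x y w : act (c *: x + y) w = c *: act x w + act y w.
Proof. exact: linearP. Qed.
Lemma actB x y w : act (x - y) w = act x w - act y w.
Proof. exact: linextB. Qed.
Lemma actZ c x w : act (c *: x) w = c *: act x w.
Proof. exact: linextZ. Qed.
Lemma act_sum (I : Type) (r : seq I) P (F : I -> kOF k) w :
  act (\sum_(i <- r | P i) F i) w = \sum_(i <- r | P i) act (F i) w.
Proof. exact: linext_sum. Qed.

Lemma rhd_act x w : rhd x << FMonom [:: w] >> = inT (act x w).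
Proof.
rewrite [x]malg_sumU act_sum rhd_suml inT_sum; apply: eq_bigr => X _.
rewrite rhdZl actZ inTZ; congr (_ *: _).
by rewrite (rhd_word_tree k X w) /act linextU.
Qed.

Lemma act_tree_mul t x w :
  act (<< FMonom [:: t] >> * x) w = linext (graft1 k t) (act x w) - act (fderiv t x) w.
Proof.
move: x; apply: linear_basis => [c x y|c x y|[X]].
- by rewrite mulrDr malg_scaleAr actD actZ.
- rewrite fderivD fderivZ (actP c x) (actP c (fderiv t x)) linextD linextZ.
  rewrite opprD addrACA.
  by congr (_ + _); exact/esym/scalerBr.
rewrite fmulU !actU fderivU act_sum /= rhd_tree_deriv; congr (_ - _).
by apply: eq_bigr => Z _; rewrite actU.
Qed.

Lemma linext_linext (T U : choiceType) (V : lmodType k) (f : U -> V)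
    (g : T -> {malg k[U]}) (x : {malg k[T]}) :
  linext f (linext g x) = linext (fun u => linext f (g u)) x.
Proof.
by rewrite [RHS]/linext linext_sum; apply: eq_bigr => u _; rewrite linextZ.
Qed.

(** Induction on the length of [X]: after [circ_cons], the term with [fderiv t] cancels against the
    correction in [act_tree_mul], and what is left is the recursion of |> in its left argument. The
    induction is on length because grafting changes the letters. *)
Lemma act_circU X Y w :
  act (circ << FMonom X >> << FMonom Y >>) w = linext (rhd_tree k X) (rhd_tree k Y w).
Proof.
have [n] := ubnP (size X); elim: n X => // n IH [|t X] /= Xn.
  rewrite circU big_seq1 /= rhd_word_nil fmulU actU.
  by rewrite {1}[rhd_tree k Y w]malg_sumU.
rewrite circ_cons actB actD act_tree_mul subrK IH // act_sum.
rewrite (linext_eq (rhd_tree_deriv t X)) linext_subsum.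
rewrite linext_linext; congr (_ - _).
rewrite big_seq [RHS]big_seq; apply: eq_bigr => Z /size_word_grafts ZX.
by rewrite IH // ZX.
Qed.

Lemma act_circ x Y w :
  act (circ x << FMonom Y >>) w = linext (act x) (rhd_tree k Y w).
Proof.
have HD y z : circ (y + z) << FMonom Y >> = circ y << FMonom Y >> + circ z << FMonom Y >>.
  by rewrite /circ /coprod !linextD.
have HZ c y : circ (c *: y) << FMonom Y >> = c *: circ y << FMonom Y >>.
  by rewrite /circ /coprod !linextZ.
move: x; apply: linear_basis => [c x y|c x y|[X]].
- by rewrite HD HZ actD actZ.
- rewrite /linext scaler_sumr -big_split; apply: eq_bigr => u _ /=.
  by rewrite actD actZ scalerDr !scalerA mulrC.
by rewrite act_circU; apply: linext_eq => u; rewrite actU.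
Qed.

(* The convolution product of f with X |-> (X |> -), for the coshuffle coproduct. *)
Definition conv (f : seq tree -> tree -> kOT k) X w : kOT k :=
  \sum_(p <- splits X) linext (f p.1) (rhd_tree k p.2 w).

(** The split with empty second word contributes [f X w] itself; in every other split [f] is
    evaluated at a shorter word, where [f] and [g] agree by induction. *)
Lemma conv_inj f g :
  (forall X w, conv f X w = conv g X w) -> forall X w, f X w = g X w.
Proof.
move=> fg X; have [n] := ubnP (size X); elim: n X => // n IH X Xn w.
have := fg X w; rewrite /conv (bigID (fun p => p.2 == [::])) /=.
rewrite [RHS](bigID (fun p => p.2 == [::])) /=.
rewrite (big_splits_nil_r (fun p => linext (f p.1) (rhd_tree k p.2 w))).
rewrite (big_splits_nil_r (fun p => linext (g p.1) (rhd_tree k p.2 w))) /=.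
rewrite !linextU.
have -> : \sum_(p <- splits X | p.2 != [::]) linext (f p.1) (rhd_tree k p.2 w)
        = \sum_(p <- splits X | p.2 != [::]) linext (g p.1) (rhd_tree k p.2 w).
  rewrite big_seq_cond [RHS]big_seq_cond; apply: eq_bigr => -[Y Z].
  case/andP=> /size_splits /= YZ Z0; apply: linext_eq => u; apply: IH.
  rewrite (leq_trans _ (_ : size X <= n)%N) // -YZ -addn1 leq_add2l.
  by case: (Z) Z0.
exact: addIr.
Qed.

(** The identity S(X_1) o X_2 = eps(X) 1, made to act on [w] through [act_circ]. *)
Lemma conv_antipode (S : {linear kOF k -> kOF k}) X w :
  is_antipode S ->
  conv (fun Y => act (S << FMonom Y >>)) X w = (X == [::])%:R *: << w >>.
Proof.
move=> /(_ << FMonom X >>)[+ _]; rewrite /coprod linextU linext_coprod1.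
move=> /(congr1 (act^~ w)); rewrite act_sum counitN actZ.
have -> : act 1 w = << w >> by rewrite kOF1E actU.
by move=> <-; apply: eq_bigr => p _; rewrite act_circ.
Qed.

(** The recursion satisfied by B(X; w). The second sum runs over words that are not subwords of the
    given one, so the recursion is on the length [n]. *)
Fixpoint brec_rec (n : nat) (X : seq tree) (w : tree) : kOT k :=
  match n, X with
  | n'.+1, t :: X' =>
      \sum_(u <- grafts t w) brec_rec n' X' u
      + \sum_(Y <- word_grafts t X') brec_rec n' Y w
  | _, _ => << w >>
  end.

Definition brec X w := brec_rec (size X) X w.

Lemma brec_cons t X w :
  brec (t :: X) w = \sum_(u <- grafts t w) brec X u + \sum_(Y <- word_grafts t X) brec Y w.
Proof.
congr (_ + _); rewrite big_seq [RHS]big_seq; apply: eq_bigr => Y /size_word_grafts YX.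
by rewrite /brec YX.
Qed.

(** The candidate for S(X) |> w. *)
Definition sbrec X w : kOT k := (-1) ^+ size X *: brec X w.

Lemma sbrec_cons t X w :
  sbrec (t :: X) w = - linext (sbrec X) (graft1 k t w) - \sum_(Y <- word_grafts t X) sbrec Y w.
Proof.
rewrite /sbrec linext_graft1 brec_cons exprS mulN1r scaleNr scalerDr opprD.
congr (- _ - _); first by rewrite scaler_sumr.
by rewrite scaler_sumr big_seq [RHS]big_seq; apply: eq_bigr => Y /size_word_grafts ->.
Qed.

Lemma sub_cancel (V : zmodType) (x y z : V) : - (- x - y + (x - z)) = y + z.
Proof. by rewrite [X in X + _]addrC -addrA addKr opprD !opprK. Qed.

(** In a split of tX, the letter t on the left contributes minus its grafting on p.2 |> w, and on
    the right plus the same; these cancel. The remaining corrections are, by [splits_word_grafts],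
    minus the sum of [conv sbrec Y w] over the graftings [Y] of t on [X]. Each such [Y] is nonempty,
    so induction gives 0. *)
Lemma conv_brec X w :
  conv sbrec X w = (X == [::])%:R *: << w >>.
Proof.
have [n] := ubnP (size X); elim: n X => // n IH [|t X] /= Xn.
  by rewrite /conv big_seq1 /= linextU /sbrec /= !scale1r.
pose g p := linext (sbrec p.1) (rhd_tree k p.2 w).
have D Y : Y \in word_grafts t X -> conv sbrec Y w = 0.
  move=> YX; rewrite IH ?(size_word_grafts YX) //; case: (X) (Y) YX (size_word_grafts YX) => //.
  by move=> x X' [|y Y'] //; rewrite scale0r.
have : \sum_(Y <- word_grafts t X) \sum_(p <- splits Y) g p = 0.
  by rewrite big_seq big1 // => Y /D.
rewrite splits_word_grafts => D0; rewrite /conv (big_splits_cons g) -big_split /=.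
rewrite scale0r; apply/oppr_inj; rewrite oppr0 -[RHS]D0 -sumrN; apply: eq_bigr => p _.
rewrite /g /= rhd_tree_deriv (linext_eq (sbrec_cons t p.1)) linext_subsum linextB.
rewrite (linext_sum (sbrec p.1) (word_grafts t p.2)).
have -> : linext (fun u => - linext (sbrec p.1) (graft1 k t u)) (rhd_tree k p.2 w)
    = - linext (sbrec p.1) (linext (graft1 k t) (rhd_tree k p.2 w)).
  by rewrite linext_linext /linext -sumrN; apply: eq_bigr => u _; rewrite scalerN.
exact: sub_cancel.
Qed.

Lemma brhd_brec (S : {linear kOF k -> kOF k}) X w :
  is_antipode S -> brhd S (FMonom X) (FMonom [:: w]) = inT (brec X w).
Proof.
move=> HS; rewrite /brhd rhd_act -inTZ; congr inT.
have -> : act (S << FMonom X >>) w = sbrec X w.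
  pose f Y := act (S << FMonom Y >>).
  apply: (@conv_inj f sbrec) => Y u.
  by rewrite conv_brec conv_antipode.
by rewrite /sbrec scalerA -expr2 sqrr_sign scale1r.
Qed.

End Antipode.

(** * The sum over permutations *)

Section Insert.
Variable I : eqType.
Implicit Types (r ks : seq I) (i x : I) (c : option I).

(** A place for a new letter is named by its future right neighbour, with [None] for the end of the
    word, where omega stands. The set of places is thus the same for all arrangements of [ks]. *)
Definition slots ks : seq (option I) := None :: map Some ks.

Definition ins i r c : seq I :=
  let j := if c is Some x then index x r else size r in take j r ++ i :: drop j r.

Lemma slots_uniq ks : uniq ks -> uniq (slots ks).
Proof.
move=> u; rewrite /= map_inj_uniq ?u ?andbT; last by move=> x y [].
by apply/mapP => -[].
Qed.

Lemma mem_slots ks c : (c \in slots ks) = if c is Some x then x \in ks else true.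
Proof. by case: c => [x|] //; rewrite in_cons mem_map // => ? ? []. Qed.

Lemma ins_split i r c : uniq r -> c \in slots r ->
  exists r1 r2, [/\ r = r1 ++ r2, ins i r c = r1 ++ i :: r2
                  & c = head None (map Some r2)].
Proof.
rewrite mem_slots; case: c => [x|] u xr; rewrite /ins; last first.
  by exists r, [::]; rewrite take_size drop_size cats0.
exists (take (index x r) r), (drop (index x r) r).
rewrite cat_take_drop; split=> //.
by rewrite (drop_nth x) ?index_mem //= nth_index.
Qed.

Lemma ins_perm i r c : uniq r -> c \in slots r -> perm_eq (ins i r c) (i :: r).
Proof.
move=> u /(ins_split i u)[r1 [r2 [-> -> _]]].
by rewrite perm_sym -cat1s perm_catCA.
Qed.

(** As [i] is not in [ks], its only occurrence cuts the word at the same position in both readings;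
    the slot is then the head of the right part. *)
Lemma ins_inj i ks r c r' c' : i \notin ks -> uniq ks ->
  perm_eq r ks -> perm_eq r' ks -> c \in slots ks -> c' \in slots ks ->
  ins i r c = ins i r' c' -> r = r' /\ c = c'.
Proof.
move=> iks u p p' cs cs' e.
have [ur ur'] : uniq r /\ uniq r' by rewrite !(perm_uniq p, perm_uniq p').
have sl s d : perm_eq s ks -> d \in slots ks -> d \in slots s.
  by move=> q; rewrite !mem_slots; case: d => // x; rewrite (perm_mem q).
have [r1 [r2 [E F G]]] := ins_split i ur (sl _ _ p cs).
have [s1 [s2 [E' F' G']]] := ins_split i ur' (sl _ _ p' cs').
have ni s d : perm_eq s ks -> i \in s -> d.
  by move=> q; rewrite (perm_mem q) (negPf iks).
have n1 : i \notin r1 by apply/negP => ir; apply: (ni _ _ p); rewrite E mem_cat ir.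
have n2 : i \notin s1 by apply/negP => ir; apply: (ni _ _ p'); rewrite E' mem_cat ir.
move: e; rewrite F F' => e.
have es : size r1 = size s1.
  have := congr1 (index i) e.
  by rewrite !index_cat (negPf n1) (negPf n2) /= eqxx !addn0.
have /andP[/eqP e1 /eqP[e2]] : (r1 == s1) && (i :: r2 == i :: s2).
  by rewrite -eqseq_cat // e.
by rewrite E E' G G' e1 e2.
Qed.

(** Insertion is injective and yields permutations, and the sizes agree because (n+1)! = n! (n+1);
    so one inclusion is enough. *)
Lemma permutations_cons i ks : uniq (i :: ks) ->
  perm_eq (permutations (i :: ks))
          [seq ins i r c | r <- permutations ks, c <- slots ks].
Proof.
move=> /[dup] uik /andP[ni u]; rewrite perm_sym.
have us : uniq [seq ins i r c | r <- permutations ks, c <- slots ks].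
  apply: allpairs_uniq; first exact: permutations_uniq.
    exact: slots_uniq.
  move=> [r c] [r' c'] h h' /= e.
  have [[a b] /= [pa pb [ra cb]]] := allpairsP h.
  have [[a' b'] /= [pa' pb' [ra' cb']]] := allpairsP h'.
  rewrite {}ra {}cb {}ra' {}cb' in h h' e *.
  by have [-> ->] := ins_inj ni u (etrans (esym (mem_permutations _ _)) pa)
     (etrans (esym (mem_permutations _ _)) pa') pb pb' e.
apply: uniq_perm => //; first exact: permutations_uniq.
apply: (uniq_min_size us _ _).2.
  move=> s /allpairsP[[r c] /= [rk ck ->]]; rewrite mem_permutations in rk.
  have ur : uniq r by rewrite (perm_uniq rk).
  rewrite mem_permutations (perm_trans (ins_perm i ur _)) ?perm_cons //.
  by move: ck; rewrite !mem_slots; case: c => // x; rewrite (perm_mem rk).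
rewrite !size_permutations // size_allpairs size_permutations // /= size_map.
by rewrite factS mulnC.
Qed.

End Insert.

Lemma perm_sum_permutations (m : nat) (V : zmodType) (F : seq 'I_m -> V) :
  \sum_(p : 'S_m) F [seq p i | i <- enum 'I_m] =
  \sum_(r <- permutations (enum 'I_m)) F r.
Proof.
rewrite -(big_map (fun p : 'S_m => [seq p i | i <- enum 'I_m]) xpredT F).
apply: perm_big; rewrite perm_sym.
have us : uniq [seq [seq p i | i <- enum 'I_m] | p : 'S_m <- index_enum _].
  rewrite map_inj_uniq ?index_enum_uniq // => p q e; apply/permP => i.
  by have /eq_in_map/(_ i) := e; rewrite mem_enum => ->.
rewrite perm_sym; apply: uniq_perm => //; first exact: permutations_uniq.
apply: (uniq_min_size us _ _).2.
  move=> s /mapP[p _ ->]; rewrite mem_permutations.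
  apply: uniq_perm; rewrite ?enum_uniq ?(map_inj_uniq perm_inj) ?enum_uniq //.
  move=> i; rewrite mem_enum; apply/mapP; exists (p^-1%g i); rewrite ?mem_enum //.
  by rewrite permKV.
rewrite size_permutations ?enum_uniq // size_enum_ord size_map.
by rewrite -[index_enum _]enumT -cardE card_Sn.
Qed.

Definition upd (I : eqType) (T : Type) (E : option I -> T) c x : option I -> T :=
  fun d => if d == c then x else E d.

Section BracketSum.
Variables (V : zmodType) (g : V -> V -> V) (I : eqType).
Implicit Types (E : option I -> V) (ks : seq I).

(** [E c] is the value of the current entry that contains the unprocessed symbol [c], with [None]
    for omega. The sum over arrangements enters only through the right neighbour [c] of the next
    symbol [i]. *)
Fixpoint bset ks E : V :=
  if ks is i :: ks' then
    \sum_(c <- slots ks') bset ks' (upd E c (g (E (Some i)) (E c)))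
  else E None.

Lemma bset_ext ks E E' : {in slots ks, E =1 E'} -> bset ks E = bset ks E'.
Proof.
elim: ks E E' => [|i ks IH] E E' e /=; first by rewrite e ?inE.
rewrite big_seq [RHS]big_seq; apply: eq_bigr => c cs.
have sub d : d \in slots ks -> d \in slots (i :: ks).
  by rewrite !mem_slots; case: d => // x; rewrite inE orbC => ->.
apply: IH => d ds; rewrite /upd; case: ifP => _; last by rewrite e ?sub.
by rewrite (e c) ?sub // (e (Some i)) // mem_slots inE eqxx.
Qed.

Hypothesis g_suml : forall (J : Type) (r : seq J) (F : J -> V) y,
  g (\sum_(j <- r) F j) y = \sum_(j <- r) g (F j) y.
Hypothesis g_sumr : forall (J : Type) (r : seq J) (F : J -> V) x,
  g x (\sum_(j <- r) F j) = \sum_(j <- r) g x (F j).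

(** A step uses the varied entry as scion, as rootstock, or not at all; these are the three cases,
    and [g] is additive in both arguments. In the first case the varied entry is consumed, and the
    sum passes to the entry of [d]. *)
Lemma bset_sum ks E c (J : Type) (r : seq J) (F : J -> V) : uniq ks ->
  c \in slots ks ->
  bset ks (upd E c (\sum_(j <- r) F j)) = \sum_(j <- r) bset ks (upd E c (F j)).
Proof.
elim: ks E c F => [|i ks IH] E c F /=.
  by move=> _; rewrite mem_slots; case: c => // _; rewrite /upd eqxx.
move=> /andP[ni u] cs; rewrite [RHS]exchange_big /= big_seq [RHS]big_seq.
apply: eq_bigr => d ds.
have [ci|ci] := eqVneq c (Some i).
  have dc : d == c = false.
    by apply/eqP => e; move: ds; rewrite e ci mem_slots (negPf ni).
  rewrite (@bset_ext _ _ (upd E d (g (\sum_(j <- r) F j) (E d)))); last first.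
    move=> x xs; rewrite /upd ci eqxx -ci dc; case: ifP => // _; case: eqP => // e.
    by move: xs; rewrite e ci mem_slots (negPf ni).
  rewrite g_suml IH //; apply: eq_bigr => j _; apply: bset_ext => x xs.
  rewrite /upd ci eqxx -ci dc; case: ifP => // _; case: eqP => // e.
  by move: xs; rewrite e ci mem_slots (negPf ni).
have ic : Some i == c = false by rewrite eq_sym (negPf ci).
have [dc|dc] := eqVneq d c.
  rewrite (@bset_ext _ _ (upd E d (g (E (Some i)) (\sum_(j <- r) F j)))); last first.
    by move=> x _; rewrite /upd ic dc eqxx; case: eqP.
  rewrite g_sumr IH //; apply: eq_bigr => j _; apply: bset_ext => x _.
  by rewrite /upd ic dc eqxx; case: eqP.
rewrite (@bset_ext _ _ (upd (upd E d (g (E (Some i)) (E d))) c (\sum_(j <- r) F j))).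
  rewrite IH //; first apply: eq_bigr => j _.
    apply: bset_ext => x _; rewrite /upd ic (negPf dc).
    by case: (eqVneq x c) => // ->; rewrite eq_sym (negPf dc).
  by move: cs ci; rewrite !mem_slots; case: c {ic dc} => // x; rewrite inE => /orP[/eqP->|//] /eqP.
move=> x _; rewrite /upd ic (negPf dc).
by case: (eqVneq x c) => // ->; rewrite eq_sym (negPf dc).
Qed.

End BracketSum.

(** Translates from positions in a word to symbols: as [ks] has no repetition, updating one symbol
    changes one letter. *)
Lemma word_grafts_upd (I : eqType) (V : zmodType) (f : seq tree -> V) t (ks : seq I)
    (F : option I -> tree) :
  uniq ks ->
  \sum_(c <- ks) \sum_(u <- grafts t (F (Some c)))
     f [seq upd F (Some c) u (Some i) | i <- ks] =
  \sum_(Y <- word_grafts t [seq F (Some i) | i <- ks]) f Y.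
Proof.
elim: ks f => [|i ks IH] f /=; first by rewrite !big_nil.
move=> /andP[ni u]; rewrite big_cons big_word_grafts_cons; congr (_ + _).
  apply: eq_bigr => v _; rewrite /upd eqxx; congr (f (_ :: _)).
  apply/eq_in_map => j js; case: eqP => // -[e]; by rewrite -e js in ni.
rewrite -(IH (fun Y => f (F (Some i) :: Y))) // big_seq [RHS]big_seq.
apply: eq_bigr => j js; apply: eq_bigr => v _; congr (f (_ :: _)).
by rewrite /upd; case: eqP => // -[e]; rewrite e js in ni.
Qed.

Section BracketTree.
Variable k : fieldType.

Lemma graft_suml (J : Type) (r : seq J) (F : J -> kOT k) y :
  graft (\sum_(j <- r) F j) y = \sum_(j <- r) graft (F j) y.
Proof. exact: linext_sum. Qed.

Lemma graft_sumr (J : Type) (r : seq J) (F : J -> kOT k) x :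
  graft x (\sum_(j <- r) F j) = \sum_(j <- r) graft x (F j).
Proof.
rewrite /graft [RHS]exchange_big /=; apply: eq_bigr => t _.
by rewrite linext_sum scaler_sumr.
Qed.

(** A graft turns an entry into a sum of trees, which [bset_sum] expands so that all entries are
    trees again. The slot [None] gives the graftings on omega, and the other slots give
    [word_grafts]. *)
Lemma bset_brec (I : eqType) (ks : seq I) (F : option I -> tree) : uniq ks ->
  bset (@graft k) ks (fun c => << F c >>) = brec k [seq F (Some i) | i <- ks] (F None).
Proof.
elim: ks F => [|i ks IH] F //= /andP[ni u]; rewrite brec_cons.
have step c : c \in slots ks ->
    bset (@graft k) ks (upd (fun c => << F c >>) c (graft << F (Some i) >> << F c >>)) =
    \sum_(u <- grafts (F (Some i)) (F c))
      brec k [seq upd F c u (Some i) | i <- ks] (upd F c u None).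
  move=> cs; rewrite /graft !linextU graft1E (bset_sum graft_suml graft_sumr) //.
  apply: eq_bigr => v _.
  by rewrite -IH //; apply: bset_ext => x _; rewrite /upd; case: eqP.
rewrite big_seq (eq_bigr _ step) -big_seq big_cons; congr (_ + _).
by rewrite -(word_grafts_upd (fun Y => brec k Y (F None))) // [LHS]big_map.
Qed.

End BracketTree.

Section BracketRun.
Variables (k : fieldType) (m : nat) (t : m.-tuple tree) (w : tree).
Implicit Types (E : option 'I_m -> gexpr m) (r ks : seq 'I_m).

(** Only the entry of [i] involves [i], so the search passes over the letters before it and merges
    it with its right neighbour, the entry of [c]. The result is an arrangement of [ks] with one
    updated entry. *)
Lemma merge_at_ins i E ks r c : i \notin ks -> uniq ks -> perm_eq r ks ->
  c \in slots ks ->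
  (forall d, d \in slots (i :: ks) -> involves i (E d) = (d == Some i)) ->
  merge_at i [seq E d | d <- rcons (map Some (ins i r c)) None] =
  [seq upd E c (Gr (E (Some i)) (E c)) d | d <- rcons (map Some r) None].
Proof.
move=> ni u p cs inv; have ur : uniq r by rewrite (perm_uniq p).
have [|r1 [r2 [rE -> cE]]] := @ins_split _ i r c ur.
  by move: cs; rewrite !mem_slots; case: (c) => // x; rewrite (perm_mem p).
have sub x : x \in r -> x \in ks by rewrite (perm_mem p).
have {p} : {subset r1 ++ r2 <= ks} by move=> x; rewrite -rE => /sub.
move: ur; rewrite {}rE; elim: r1 => [|x r1 IH] /= ur rk.
  (* The search has reached [i]; if [r2] is empty, the right neighbour is omega. *)
  rewrite inv ?mem_slots ?inE ?eqxx //.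
  case: r2 cE ur rk => [|y r2] /= -> ur rk; first by rewrite /upd eqxx.
  rewrite /upd eqxx; congr (_ :: _); apply/eq_in_map => d.
  rewrite mem_rcons inE => /orP[/eqP -> //|/mapP[z zr ->]].
  by case: eqP => // -[e]; rewrite -e zr in ur.
have xk : x \in ks by apply: rk; rewrite inE eqxx.
rewrite inv ?mem_slots ?inE ?xk ?orbT //.
have xi : Some x == Some i = false.
  by apply/eqP => -[e]; rewrite -e xk in ni.
have xc : Some x == c = false.
  apply/eqP => e; move: ur; rewrite mem_cat => /andP[/norP[_ xr2] _].
  by move: cE xr2; rewrite -e; case: (r2) => //= ? ? [->]; rewrite inE eqxx.
rewrite xi -IH; last first.
- by move=> z zr; apply: rk; rewrite inE zr orbT.
- by case/andP: ur.
rewrite {1}/upd xc map_rcons map_cat /=.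
by case: (r1).
Qed.

(** The invariant is that, among the symbols still to be processed, [E d] involves [d] only. Summing
    over permutations of [i :: ks] means summing over an arrangement of [ks] and a slot for [i];
    merging restores the same situation for [ks]. *)
Lemma sum_run ks E : uniq ks ->
  (forall i d, i \in ks -> d \in slots ks -> involves i (E d) = (d == Some i)) ->
  \sum_(r <- permutations ks)
     geval k t w (head (Defs.Sym None)
       (foldl (fun s i => merge_at i s) [seq E d | d <- rcons (map Some r) None] ks))
  = bset (@graft k) ks (fun d => geval k t w (E d)).
Proof.
elim: ks E => [|i ks IH] E u inv; first by rewrite big_seq1.
have [ni uk] := andP u.
rewrite (perm_big _ (permutations_cons u)) big_allpairs_dep exchange_big /=.
rewrite big_seq [RHS]big_seq; apply: eq_bigr => c cs.
transitivity (bset (@graft k) ks (fun d => geval k t w (upd E c (Gr (E (Some i)) (E c)) d))).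
  rewrite -IH //; last first.
    move=> j d jk ds; have ji : Some i == Some j = false.
      by apply/eqP => -[e]; rewrite e jk in ni.
    have sub x : x \in slots ks -> x \in slots (i :: ks).
      by rewrite !mem_slots; case: x => // x; rewrite inE orbC => ->.
    have jk' : j \in i :: ks by rewrite inE jk orbT.
    rewrite /upd; case: (eqVneq d c) => [->|_]; last by rewrite inv ?sub.
    have iks : Some i \in slots (i :: ks) by rewrite mem_slots inE eqxx.
    by rewrite /= (inv j _ jk' iks) (inv j _ jk' (sub _ cs)) ji.
  rewrite big_seq [RHS]big_seq; apply: eq_bigr => r.
  rewrite mem_permutations => rk; rewrite (@merge_at_ins i E ks) // => d ds.
  by apply: inv => //; rewrite inE eqxx.
by apply: bset_ext => d _; rewrite /upd; case: eqP.
Qed.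

Lemma sum_bracket : \sum_(p : 'S_m) bracket k t w p = brec k t w.
Proof.
pose F r := geval k t w (head (Defs.Sym None)
  (foldl (fun s i => merge_at i s)
     (rcons [seq Defs.Sym (Some i) | i <- r] (Defs.Sym None)) (enum 'I_m))).
transitivity (\sum_(p : 'S_m) F [seq p i | i <- enum 'I_m]).
  by apply: eq_bigr => p _; rewrite /F -map_comp.
rewrite perm_sum_permutations.
transitivity (bset (@graft k) (enum 'I_m) (fun d => << Defs.comp t w d >> : kOT k)).
  rewrite -(@sum_run (enum 'I_m) Defs.Sym) ?enum_uniq //.
  by apply: eq_bigr => r _; rewrite /F map_rcons -map_comp.
by rewrite bset_brec ?enum_uniq // map_tnth_enum.
Qed.

End BracketRun.

(** * The sum over assignments *)

Lemma tree_nested_ind (P : tree -> Prop) :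
  (forall ts, foldr (fun t => and (P t)) True ts -> P (Node ts)) -> forall t, P t.
Proof. by move=> H; fix IH 1; case=> ts; apply: H; elim: ts => //= t ts; split. Qed.

Lemma set_nth_mid (T : Type) (x0 x y : T) s1 s2 :
  set_nth x0 (s1 ++ x :: s2) (size s1) y = s1 ++ y :: s2.
Proof. by elim: s1 => //= z s1 ->. Qed.

Fixpoint nodes_from (i : nat) (us : seq tree) : seq (seq nat) :=
  if us is u :: us' then map (cons i) (nodes u) ++ nodes_from i.+1 us' else [::].

Lemma nodesE ts : nodes (Node ts) = [::] :: nodes_from 0 ts.
Proof. by []. Qed.

Lemma nodes_from_ge i us a : a \in nodes_from i us -> exists j b, a = j :: b /\ (i <= j)%N.
Proof.
elim: us i => [|u us IH] i //=; rewrite mem_cat => /orP[/mapP[b _ ->]|/IH].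
  by exists i, b.
by case=> j [b [-> ij]]; exists j, b; split=> //; apply: ltnW.
Qed.

Lemma nodes_uniq t : uniq (nodes t).
Proof.
elim/tree_nested_ind: t => ts IH; rewrite nodesE /=; apply/andP; split.
  by apply/negP => /nodes_from_ge[j [b []]].
elim: ts (0%N) IH => //= u us IHus i [Hu Hus].
rewrite cat_uniq map_inj_uniq ?Hu ?IHus //= ?andbT; last by move=> ? ? [].
apply/hasPn => a /nodes_from_ge[j [b [-> ij]]]; apply/negP => /mapP[c _ [e _]].
by rewrite e ltnn in ij.
Qed.

(** * Labelled trees and grafting at a label *)

Section LabelledTrees.
Variable N : eqType.

Inductive ltree : Type := LNode of N & seq ltree.

Lemma ltree_nested_ind (P : ltree -> Prop) :
  (forall v ts, foldr (fun t => and (P t)) True ts -> P (LNode v ts)) -> forall t, P t.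
Proof. by move=> H; fix IH 1; case=> v ts; apply: H; elim: ts => //= t ts; split. Qed.

Definition lroot (L : ltree) : N := let: LNode v _ := L in v.

Fixpoint labels (L : ltree) : seq N :=
  let: LNode v ts := L in v :: flatten (map labels ts).

Definition flabels (Ls : seq ltree) : seq N := flatten (map labels Ls).

Fixpoint erase (L : ltree) : tree := let: LNode _ ts := L in Node (map erase ts).

(** Leaves a tree without the label [v] unchanged, so it can be mapped over all current trees; with
    distinct labels only one of them changes, at one node. *)
Fixpoint lgraft (x : ltree) (v : N) (L : ltree) : ltree :=
  let: LNode u ts := L in
  LNode u ((if u == v then [:: x] else [::]) ++ map (lgraft x v) ts).

(** A consistent labelled tree is determined by [ch] and its root label, which is what
    [erase_unfold] exploits. *)
Fixpoint consist (ch : N -> seq N) (L : ltree) : bool :=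
  let: LNode v ts := L in (map lroot ts == ch v) && all (consist ch) ts.

Implicit Types (L x w : ltree) (Ls X : seq ltree) (v : N).

Lemma lroot_labels L : lroot L \in labels L.
Proof. by case: L => v ts; rewrite inE eqxx. Qed.

Lemma lroot_lgraft x v L : lroot (lgraft x v L) = lroot L.
Proof. by case: L. Qed.

Lemma flabels_cons L Ls : flabels (L :: Ls) = labels L ++ flabels Ls.
Proof. by []. Qed.

Lemma flabels_cat Ls Ls' : flabels (Ls ++ Ls') = flabels Ls ++ flabels Ls'.
Proof. by rewrite /flabels map_cat flatten_cat. Qed.

Lemma lgraft_id x v L : v \notin labels L -> lgraft x v L = L.
Proof.
elim/ltree_nested_ind: L => u ts IH /=; rewrite inE negb_or eq_sym.
case/andP=> /negPf -> vts; congr LNode; move: vts => /=.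
elim: ts IH => //= L ts IHts [HL Hts]; rewrite mem_cat negb_or => /andP[vL vts].
by rewrite HL // IHts.
Qed.

Lemma map_lgraft_id x v Ls : v \notin flabels Ls -> map (lgraft x v) Ls = Ls.
Proof.
elim: Ls => //= L Ls IH; rewrite flabels_cons mem_cat negb_or => /andP[vL vLs].
by rewrite lgraft_id // IH.
Qed.

Lemma uniq_flabels_split Ls L Ls' v : uniq (flabels (Ls ++ L :: Ls')) ->
  v \in labels L -> (v \notin flabels Ls) && (v \notin flabels Ls').
Proof.
rewrite flabels_cat flabels_cons cat_uniq cat_uniq => /and3P[_ h /and3P[_ h' _]] vL.
apply/andP; split.
  by apply: contra h => vLs; apply/hasP; exists v; rewrite ?mem_cat ?vL.
by apply: contra h' => vLs; apply/hasP; exists v.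
Qed.

(** Addresses and labels are both listed in preorder, so the two lists of graftings agree entry by
    entry. *)
Lemma grafts_erase x L : uniq (labels L) ->
  grafts (erase x) (erase L) = [seq erase (lgraft x v L) | v <- labels L].
Proof.
elim/ltree_nested_ind: L => v ts IH /=; rewrite -/(flabels ts) => /andP[vts uts].
rewrite /grafts nodesE /= eqxx map_lgraft_id //=; congr (_ :: _).
have nv u : u \in flabels ts -> v == u = false.
  by move=> uts'; apply/eqP => e; rewrite e uts' in vts.
(* [pre] holds the children already passed, so that the first index in the addresses is
   [size pre]. *)
suff H pre us : foldr (fun t => and (uniq (labels t) ->
    grafts (erase x) (erase t) = [seq erase (lgraft x v t) | v <- labels t])) True us ->
    uniq (flabels (pre ++ us)) ->
    [seq graft_at (erase x) (Node (map erase (pre ++ us))) b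
       | b <- nodes_from (size pre) (map erase us)] =
    [seq Node (map erase (map (lgraft x u) (pre ++ us))) | u <- flabels us].
  have /= -> := H [::] ts IH uts.
  by apply/eq_in_map => u /nv ->.
elim: us pre => //= L us IHus pre [HL Hus] upu.
rewrite flabels_cons [LHS]map_cat [RHS]map_cat; congr (_ ++ _); last first.
  by have := IHus (rcons pre L) Hus; rewrite cat_rcons size_rcons => /(_ upu) <-.
have uL : uniq (labels L).
  move: upu; rewrite flabels_cat flabels_cons !cat_uniq => /and3P[_ _].
  by case/and3P.
transitivity [seq Node (map erase pre ++ Y :: map erase us)
               | Y <- grafts (erase x) (erase L)].
  rewrite -!map_comp; apply: eq_map => a /=; congr Node.
  by rewrite map_cat /= -(size_map erase pre) set_nth_mid nth_cat ltnn subnn.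
rewrite HL // -map_comp; apply/eq_in_map => u uL' /=.
have /andP[up uu] := uniq_flabels_split upu uL'.
by rewrite map_cat /= !map_lgraft_id // map_cat.
Qed.

Lemma word_grafts_erase x Ls : uniq (flabels Ls) ->
  word_grafts (erase x) (map erase Ls)
  = [seq map erase (map (lgraft x v) Ls) | v <- flabels Ls].
Proof.
elim: Ls => //= L Ls IH; rewrite flabels_cons map_cat => uLs.
have [uL uu] : uniq (labels L) /\ uniq (flabels Ls).
  by move: uLs; rewrite cat_uniq => /and3P[].
rewrite grafts_erase // IH // -!map_comp; congr (_ ++ _); apply/eq_in_map => v vL /=.
  by have /andP[_ h] := uniq_flabels_split (Ls := [::]) uLs vL; rewrite map_lgraft_id.
rewrite lgraft_id //; apply/negP => vL'.
by have := uniq_flabels_split (Ls := [::]) uLs vL'; rewrite vL andbF.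
Qed.

Lemma count_lgraft (a : pred N) x v L :
  count a (labels (lgraft x v L))
  = (count a (labels L) + count_mem v (labels L) * count a (labels x))%N.
Proof.
elim/ltree_nested_ind: L => u ts IH /=; rewrite -addnA; congr (_ + _)%N.
rewrite map_cat flatten_cat count_cat mulnDl addnCA; congr (_ + _)%N.
  by case: (u == v) => //=; rewrite cats0 mul1n.
elim: ts IH => //= L ts IHts [HL Hts].
by rewrite !count_cat HL IHts // mulnDl addnACA.
Qed.

Lemma perm_flabels_lgraft x v Ls : uniq (flabels Ls) -> v \in flabels Ls ->
  perm_eq (flabels (map (lgraft x v) Ls)) (labels x ++ flabels Ls).
Proof.
move=> u vLs; apply/seq.permP => a; rewrite count_cat addnC.
transitivity (count a (flabels Ls) + count_mem v (flabels Ls) * count a (labels x))%N.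
  elim: Ls {u vLs} => //= L Ls IH.
  by rewrite !flabels_cons !count_cat count_lgraft IH mulnDl addnACA.
by rewrite count_uniq_mem // vLs mul1n.
Qed.

Lemma consist_lgraft ch ch' x v L :
  (forall u, ch' u = (if u == v then [:: lroot x] else [::]) ++ ch u) ->
  consist ch L -> consist ch' x -> consist ch' (lgraft x v L).
Proof.
move=> chE cL cx; elim/ltree_nested_ind: L cL => u ts IH /= /andP[/eqP ets cts].
rewrite chE map_cat -ets -map_comp all_cat (eq_map (lroot_lgraft x v)).
apply/and3P; split; first by case: ifP.
  by case: ifP => //=; rewrite cx.
elim: ts IH cts {ets} => //= L ts IHts [HL Hts] /andP[cL cts].
by rewrite HL ?IHts.
Qed.

Lemma consist_ext ch ch' L :
  {in labels L, ch =1 ch'} -> consist ch L = consist ch' L.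
Proof.
elim/ltree_nested_ind: L => u ts IH /= e; rewrite e ?inE ?eqxx //; congr andb.
have {}e : {in flabels ts, ch =1 ch'} by move=> z zt; rewrite e // inE zt orbT.
elim: ts IH e => //= L ts IHts [HL Hts] e.
rewrite HL ?IHts // => z zt; apply: e; rewrite flabels_cons mem_cat zt ?orbT //.
Qed.

Section Parent.
Variables (ch : N -> seq N) (parent : N -> N).
Hypothesis parentP : forall u v, u \in ch v -> parent u = v.

Lemma consist_parent L u : consist ch L -> u \in labels L ->
  u != lroot L -> parent u \in labels L.
Proof.
elim/ltree_nested_ind: L => v ts IH /= /andP[/eqP ets cts].
rewrite inE => /orP[->//|uts] _; rewrite -/(flabels ts) in uts *.
have {ets} : {subset map lroot ts <= ch v} by rewrite ets.
rewrite inE; elim: ts IH cts uts => //= L ts IHts [HL Hts] /andP[cL cts].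
rewrite flabels_cons !mem_cat => /orP[uL|uts] rs; last first.
  have {}rs : {subset map lroot ts <= ch v} by move=> z zt; rewrite rs // inE zt orbT.
  have /orP[->//|->] := IHts Hts cts uts rs.
  by rewrite !orbT.
have [uE|uE] := eqVneq u (lroot L).
  by rewrite (parentP (rs u _)) ?eqxx // inE uE eqxx.
by rewrite HL ?orbT.
Qed.

(** By induction on the tree, with one more step from the root of a child to its parent. The bound
    keeps the climb within the number of steps allowed in [is_grafting]. *)
Lemma consist_iter L u : consist ch L -> u \in labels L ->
  exists2 n, (n < size (labels L))%N & iter n parent u = lroot L.
Proof.
elim/ltree_nested_ind: L => v ts IH /= /andP[/eqP ets cts].
rewrite inE => /orP[/eqP ->|uts]; first by exists 0%N.
have {ets} : {subset map lroot ts <= ch v} by rewrite ets.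
elim: ts IH cts uts => //= L ts IHts [HL Hts] /andP[cL cts].
rewrite mem_cat => /orP[uL|uts] rs; last first.
  have {}rs : {subset map lroot ts <= ch v} by move=> z zt; rewrite rs // inE zt orbT.
  have [n ns e] := IHts Hts cts uts rs.
  by exists n => //; rewrite size_cat (leq_trans ns) // ltnS leq_addl.
have [n ns e] := HL cL uL; exists n.+1.
  by rewrite ltnS size_cat (leq_trans ns) // leq_addr.
by rewrite iterS e (parentP (rs _ _)) // inE eqxx.
Qed.
End Parent.

(** One branch of the recursion, in which [vs] prescribes where each tree is attached. Among the
    labels present, the forbidden ones are those of [x] itself, which would close a cycle. *)
Fixpoint lrun (vs : seq N) (X : seq ltree) (w : ltree) : option ltree :=
  match vs, X with
  | v :: vs', x :: X' =>
      if v \in flabels (w :: X') then lrun vs' (map (lgraft x v) X') (lgraft x v w)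
      else None
  | _, _ => Some w
  end.

Fixpoint words (s : seq N) (n : nat) : seq (seq N) :=
  if n is n'.+1 then [seq v :: vs | v <- s, vs <- words s n'] else [:: [::]].

Lemma size_words s n : size (words s n) = (size s ^ n)%N.
Proof. by elim: n => //= n IH; rewrite size_allpairs IH expnS. Qed.

Lemma words_uniq s n : uniq s -> uniq (words s n).
Proof.
move=> us; elim: n => //= n IH; apply: allpairs_uniq => //.
by move=> [a b] [c d] _ _ /= [-> ->].
Qed.

Lemma mem_words s vs : {subset vs <= s} -> vs \in words s (size vs).
Proof.
elim: vs => //= v vs IH sub; apply/allpairsP; exists (v, vs); split=> //=.
  by apply: sub; rewrite inE eqxx.
by apply: IH => z zv; apply: sub; rewrite inE zv orbT.
Qed.

Lemma perm_lgraft_step x v w X : uniq (flabels (w :: x :: X)) ->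
  v \in flabels (w :: X) ->
  perm_eq (flabels (lgraft x v w :: map (lgraft x v) X)) (flabels (w :: x :: X)).
Proof.
move=> u vX; have p : perm_eq (labels x ++ flabels (w :: X)) (flabels (w :: x :: X)).
  by rewrite !flabels_cons perm_catCA.
have uwX : uniq (flabels (w :: X)).
  by move: u; rewrite -(perm_uniq p) cat_uniq => /and3P[].
exact: perm_trans (perm_flabels_lgraft x uwX vX) p.
Qed.

(** Each step of [brec] is a choice of a label in [w] or in a remaining tree. Grafting only
    rearranges the labels, so all choices come from the fixed list [s], and failed runs contribute
    0. *)
Lemma brec_lrun (k : fieldType) s X w : uniq s -> perm_eq (flabels (w :: X)) s ->
  brec k (map erase X) (erase w) =
  \sum_(vs <- words s (size X)) oapp (fun L => << erase L >>) 0 (lrun vs X w).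
Proof.
move=> us; have [n] := ubnP (size X); elim: n X w => // n IH [|x X] w /= Xn ps.
  by rewrite big_seq1.
have u : uniq (flabels (w :: x :: X)) by rewrite (perm_uniq ps).
have p : perm_eq (labels x ++ flabels (w :: X)) (flabels (w :: x :: X)).
  by rewrite !flabels_cons perm_catCA.
have uwX : uniq (flabels (w :: X)).
  by move: u; rewrite -(perm_uniq p) cat_uniq => /and3P[].
have [uw uX] : uniq (labels w) /\ uniq (flabels X).
  by move: uwX; rewrite cat_uniq => /and3P[].
have nid v : v \in flabels (w :: X) -> (v \notin labels w) || (v \notin flabels X).
  move=> _; rewrite -negb_and; apply/negP => /andP[vw vX].
  by have := uniq_flabels_split (Ls := [::]) uwX vw; rewrite vX andbF.
rewrite big_allpairs_dep brec_cons grafts_erase // word_grafts_erase // !big_map.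
pose f v := brec k (map erase (map (lgraft x v) X)) (erase (lgraft x v w)).
transitivity (\sum_(v <- flabels (w :: X)) f v).
  rewrite flabels_cons big_cat; congr (_ + _); rewrite big_seq [RHS]big_seq; apply: eq_bigr => v vw.
    have := nid v; rewrite mem_cat vw => /(_ isT) vX.
    by rewrite /f map_lgraft_id.
  have := nid v; rewrite mem_cat vw orbT orbF => /(_ isT) vX.
  by rewrite /f lgraft_id.
(* The other labels of [s] are those of [x], for which the run fails. *)
transitivity (\sum_(v <- s | v \in flabels (w :: X)) f v).
  rewrite -[RHS]big_filter; apply: perm_big; apply: uniq_perm => //.
    exact: filter_uniq.
  move=> v; rewrite mem_filter -(perm_mem ps) -(perm_mem p) mem_cat.
  by case: (v \in flabels (w :: X)); rewrite ?orbT.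
rewrite [LHS]big_mkcond; apply: eq_bigr => v _ /=.
case: ifP => vX; last by rewrite big1.
rewrite /f IH ?size_map //; apply: perm_trans ps.
exact: perm_lgraft_step.
Qed.

Section Run.
Variables (I : eqType) (tg rt : I -> N) (base : N -> seq N).

(** The children of [v] once the trees indexed by [ds] have been grafted in that order: each new
    scion is leftmost, whence the reversal. *)
Definition chk (ds : seq I) (v : N) : seq N :=
  [seq rt i | i <- rev ds & tg i == v] ++ base v.

Lemma chk_rcons ds i v :
  chk (rcons ds i) v = (if v == tg i then [:: rt i] else [::]) ++ chk ds v.
Proof. by rewrite /chk rev_rcons /= eq_sym; case: ifP. Qed.

(** The children function changes only at [v]. Labels are distinct and [v] lies outside of [x], so
    [x] stays consistent and [consist_lgraft] applies to the other trees. *)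
Lemma run_step ds i x v w X : v = tg i -> lroot x = rt i ->
  uniq (flabels (w :: x :: X)) -> v \in flabels (w :: X) ->
  all (consist (chk ds)) (w :: x :: X) ->
  all (consist (chk (rcons ds i))) (lgraft x v w :: map (lgraft x v) X).
Proof.
move=> vE xE u vX /= /and3P[cw cx cX].
have chE z : chk (rcons ds i) z = (if z == v then [:: lroot x] else [::]) ++ chk ds z.
  by rewrite chk_rcons -vE xE.
have cx' : consist (chk (rcons ds i)) x.
  rewrite -(@consist_ext (chk ds)) // => z zx; rewrite chE; case: eqP => // zv.
  have := @uniq_flabels_split [:: w] x X v u; rewrite -zv => /(_ zx) /andP[h1 h2].
  move: vX; rewrite -zv flabels_cons mem_cat (negPf h2) orbF => h.
  by rewrite flabels_cons cats0 h in h1.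
rewrite /= (consist_lgraft chE) //= all_map; apply: sub_all cX => L cL.
exact: consist_lgraft chE cL cx'.
Qed.

Lemma lrun_sound ds ks X w L : map lroot X = map rt ks ->
  uniq (flabels (w :: X)) -> all (consist (chk ds)) (w :: X) ->
  lrun (map tg ks) X w = Some L ->
  [/\ consist (chk (ds ++ ks)) L, perm_eq (labels L) (flabels (w :: X))
    & lroot L = lroot w].
Proof.
elim: ks ds X w => [|i ks IH] ds [|x X] w //=.
  by rewrite cats0 andbT => _ _ cw [<-]; rewrite flabels_cons cats0.
case=> xE XE u c; case: ifP => // vX run.
have p := perm_lgraft_step u vX.
have [|||cL pL rL] := IH (rcons ds i) _ _ _ _ _ run.
- by rewrite -map_comp (eq_map (lroot_lgraft _ _)).
- by rewrite (perm_uniq p).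
- exact: run_step.
by rewrite cat_rcons in cL; split; rewrite ?(perm_trans pL) // rL lroot_lgraft.
Qed.

Variable parent : N -> N.
Hypothesis parent_rt : forall i, parent (rt i) = tg i.
Hypothesis parent_base : forall u v, u \in base v -> parent u = v.

Lemma parent_chk ds u v : u \in chk ds v -> parent u = v.
Proof.
rewrite mem_cat => /orP[/mapP[i]|]; last exact: parent_base.
by rewrite mem_filter => /andP[/eqP <- _ ->].
Qed.

(* If tau_i were attached inside the tree that it carries, climbing from its
   root would never leave that tree. *)
Lemma lrun_complete ds ks X w : map lroot X = map rt ks ->
  uniq (flabels (w :: X)) -> all (consist (chk ds)) (w :: X) ->
  (forall i, i \in ks -> tg i \in flabels (w :: X)) ->
  (forall u, u \in flabels (w :: X) -> exists n, iter n parent u = lroot w) ->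
  lrun (map tg ks) X w.
Proof.
elim: ks ds X w => [|i ks IH] ds [|x X] w //= [xE XE] u c tin climb.
have p : perm_eq (labels x ++ flabels (w :: X)) (flabels (w :: x :: X)).
  by rewrite !flabels_cons perm_catCA.
have vX : tg i \in flabels (w :: X).
  have := tin i (mem_head _ _); rewrite -(perm_mem p) mem_cat => /orP[vx|//].
  have cx : consist (chk ds) x by case/and3P: c.
  have closed z n : z \in labels x -> iter n parent z \in labels x.
    move=> zx; elim: n => //= n; move: (iter n parent z) => y yx.
    have [->|yr] := eqVneq y (lroot x); first by rewrite xE parent_rt.
    exact: (consist_parent (@parent_chk ds)).
  have [|n e] := climb (tg i); first by rewrite -(perm_mem p) mem_cat vx.
  have := closed _ n vx; rewrite e => wx.
  have := @uniq_flabels_split [:: w] x X _ u wx.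
  by rewrite flabels_cons cats0 lroot_labels.
rewrite vX; have q := perm_lgraft_step u vX.
apply: (IH (rcons ds i)).
- by rewrite -map_comp (eq_map (lroot_lgraft _ _)).
- by rewrite (perm_uniq q).
- exact: run_step.
- by move=> j jk; rewrite (perm_mem q) tin // inE jk orbT.
- by move=> z; rewrite (perm_mem q) lroot_lgraft; apply: climb.
Qed.
End Run.

End LabelledTrees.

(** * Labelling nodes by the tree of origin and the original address *)

Section Annotation.
Variables (C : eqType) (c : C).

Fixpoint annot (a : seq nat) (t : tree) : ltree (C * seq nat)%type :=
  let: Node ts := t in
  let fix below i us :=
    if us is u :: us' then annot (rcons a i) u :: below i.+1 us' else [::] in
  LNode (c, a) (below 0%N ts).

Definition annot_from a := fix below i us :=
  if us is u :: us' then annot (rcons a i) u :: below i.+1 us' else [::].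

Lemma annotE a ts : annot a (Node ts) = LNode (c, a) (annot_from a 0 ts).
Proof. by []. Qed.

Lemma erase_annot a t : erase (annot a t) = t.
Proof.
elim/tree_nested_ind: t a => ts IH a; rewrite annotE /=; congr Node.
by elim: ts (0%N) IH => //= t ts IHts i [-> /IHts ->].
Qed.

Lemma lroot_annot a t : lroot (annot a t) = (c, a).
Proof. by case: t. Qed.

Lemma labels_annot a t : labels (annot a t) = [seq (c, a ++ b) | b <- nodes t].
Proof.
elim/tree_nested_ind: t a => ts IH a; rewrite annotE nodesE /= cats0; congr (_ :: _).
elim: ts (0%N) IH => //= t ts IHts i [Ht Hts].
rewrite Ht IHts // map_cat -map_comp; congr (_ ++ _).
by apply: eq_map => b /=; rewrite cat_rcons.
Qed.

Lemma subtree_rcons t a i : subtree t (rcons a i) = nth leaf (children (subtree t a)) i.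
Proof. by elim: a t => //= j a IH t; rewrite IH. Qed.

Lemma consist_annot ch T a t :
  (forall b, ch (c, b) = [seq (c, rcons b j) | j <- iota 0 (size (children (subtree T b)))]) ->
  subtree T a = t -> consist ch (annot a t).
Proof.
move=> chE; elim/tree_nested_ind: t a => ts IH a aE; rewrite annotE /= chE aE /=.
apply/andP; split.
  by elim: ts (0%N) {IH aE} => //= t ts IHts i; rewrite lroot_annot eqseq_cons eqxx IHts.
(* The summand 0 is the index of the first child, to be generalised in the induction on the list. *)
have {aE}: forall i, subtree T (rcons a (0 + i)%N) = nth leaf ts i.
  by move=> i; rewrite subtree_rcons aE.
elim: ts (0%N) IH => //= t ts IHts i [Ht Hts] sub.
rewrite Ht; last by have := sub 0%N; rewrite addn0.
by apply: IHts => // j; rewrite addSnnS sub.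
Qed.
End Annotation.

(** * Assignments and successful runs *)

Section GraftingSum.
Variables (m : nat) (t : m.-tuple tree) (w : tree).
Implicit Type s : assignment t w.

Let X0 : seq (ltree (gnode m)) :=
  [seq annot (Some i) [::] (tnth t i) | i <- enum 'I_m].
Let w0 : ltree (gnode m) := annot None [::] w.

Lemma gnodes_uniq : uniq (gnodes t w).
Proof.
apply: allpairs_uniq_dep; first exact: enum_uniq.
  by move=> c _; exact: nodes_uniq.
by move=> [c a] [d b] _ _ /= [-> ->].
Qed.

Lemma perm_gnodes : perm_eq (flabels (w0 :: X0)) (gnodes t w).
Proof.
have -> : flabels (w0 :: X0) =
    [seq (c, a) | c <- None :: map Some (enum 'I_m), a <- nodes (Defs.comp t w c)].
  rewrite /flabels /= labels_annot -map_comp; congr (_ ++ flatten _).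
  by rewrite -map_comp; apply: eq_map => i /=; rewrite labels_annot.
apply: perm_allpairs_dep => //; apply: uniq_perm; rewrite ?enum_uniq //.
  by rewrite /= map_inj_uniq ?enum_uniq ?andbT; [apply/mapP => -[] | move=> ? ? []].
by move=> [i|]; rewrite mem_enum inE // mem_map ?mem_enum // => ? ? [].
Qed.

Lemma gparent_root s i : gparent s (Some i, [::]) = target s i.
Proof. by []. Qed.

(** The second half of [gchildren], which is by conversion [chk] for this base and the list of all
    indices. *)
Definition orig_children (v : gnode m) : seq (gnode m) :=
  [seq (v.1, rcons v.2 j)
     | j <- iota 0 (size (children (subtree (Defs.comp t w v.1) v.2)))].

Lemma gparent_orig s u v : u \in orig_children v -> gparent s u = v.
Proof.
case: v => c a /mapP[j _ ->]; rewrite /gparent /=.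
case e: (rcons a j) => [|h r]; first by case: (a) e.
by rewrite -e size_rcons /= -cats1 take_size_cat.
Qed.

(** The number of labels bounds the depth, so the truncation in [unfold_tree] is never reached. *)
Lemma erase_unfold s (L : ltree (gnode m)) n : consist (gchildren s) L ->
  (size (labels L) <= n)%N -> erase L = unfold_tree s n (lroot L).
Proof.
elim/ltree_nested_ind: L n => v ts IH [|n] //= /andP[/eqP <- cts] sz; congr Node.
elim: ts IH cts sz => //= L ts IHts [HL Hts] /andP[cL cts].
rewrite size_cat ltnS => sz; congr (_ :: _).
  by apply: HL => //; apply: leq_trans sz; rewrite leq_addr.
by apply: IHts => //; rewrite ltnS; apply: leq_trans sz; rewrite leq_addl.
Qed.

Lemma lrun_grafting s :
  is_grafting s = lrun [seq target s i | i <- enum 'I_m] X0 w0 :> bool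
  /\ forall L, lrun [seq target s i | i <- enum 'I_m] X0 w0 = Some L ->
       erase L = grafting s.
Proof.
have XE : map (@lroot _) X0 = [seq (Some i, [::]) | i <- enum 'I_m].
  by rewrite -map_comp; apply: eq_map => i /=; rewrite lroot_annot.
have u0 : uniq (flabels (w0 :: X0)) by rewrite (perm_uniq perm_gnodes) gnodes_uniq.
have c0 : all (consist (chk (target s) (fun i => (Some i, [::])) orig_children [::])) (w0 :: X0).
  have cc c : consist (chk (target s) (fun i => (Some i, [::])) orig_children [::])
      (annot c [::] (Defs.comp t w c)).
    apply: consist_annot => [b|//]; exact: erefl.
  by rewrite /= (cc None) /=; rewrite all_map; apply/allP => i _; exact: (cc (Some i)).
have sound L : lrun [seq target s i | i <- enum 'I_m] X0 w0 = Some L ->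
    [/\ consist (gchildren s) L, perm_eq (labels L) (gnodes t w) & lroot L = groot m].
  move=> /(lrun_sound XE u0 c0)[cL pL ->]; split; [exact: cL | | exact: lroot_annot].
  exact: perm_trans pL perm_gnodes.
split; last first.
  move=> L /sound[cL pL rL].
  by rewrite (erase_unfold (n := size (gnodes t w)) cL) ?rL ?(perm_size pL).
apply/idP/idP => [/andP[_ /allP climb]|].
  apply: (lrun_complete (gparent_root s) (@gparent_orig s) XE u0 c0).
    by move=> i _; rewrite (perm_mem perm_gnodes); exact: ssvalP.
  move=> v; rewrite (perm_mem perm_gnodes) => /climb /eqP e.
  by exists (size (gnodes t w)); rewrite e lroot_annot.
case E: (lrun _ _ _) => [L|] // _; have [cL pL rL] := sound _ E.
have par v z : v \in gchildren s z -> gparent s v = z.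
  exact: (parent_chk (gparent_root s) (@gparent_orig s)).
have climb v : v \in gnodes t w -> iter (size (gnodes t w)) (gparent s) v = groot m.
  rewrite -(perm_mem pL) => /(consist_iter par cL)[n].
  (* The root is reached in fewer steps than there are nodes, and [gparent] fixes it during the
     others. *)
  rewrite (perm_size pL) rL => nlt e; rewrite -(subnK (ltnW nlt)) iterD e.
  by elim: (_ - _)%N => //= j ->.
apply/andP; split; last by apply/allP => v /climb ->.
apply/forallP => i; apply/eqP => ti.
(* If [tau_i] were attached to one of its own nodes, climbing from its root would stay in [tau_i]
   and miss the root of omega. *)
have inv n : (iter n (gparent s) (Some i, [::])).1 = Some i.
  elim: n => //= n; case: (iter _ _ _) => [c a] /= ->.
  by case: a => [|h a] //=.
have := inv (size (gnodes t w)); rewrite climb //.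
rewrite -(perm_mem perm_gnodes) flabels_cons mem_cat; apply/orP; right.
apply/flattenP; exists (labels (annot (Some i) [::] (tnth t i))).
  by rewrite -map_comp; apply/mapP; exists i; rewrite ?mem_enum.
by rewrite -[X in X \in _](lroot_annot (Some i) [::] (tnth t i)) lroot_labels.
Qed.

(** Distinct assignments give distinct words over the nodes, and both sets have the same number of
    elements, a power with exponent [m]. *)
Lemma sum_words (V : zmodType) (F : seq (gnode m) -> V) :
  \sum_(vs <- words (gnodes t w) m) F vs =
  \sum_(s : assignment t w) F [seq target s i | i <- enum 'I_m].
Proof.
rewrite -(big_map (fun s : assignment t w => [seq target s i | i <- enum 'I_m]) xpredT F).
apply: perm_big; rewrite perm_sym.
have us : uniq [seq [seq target s i | i <- enum 'I_m] | s : assignment t w <- index_enum _].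
  rewrite map_inj_uniq ?index_enum_uniq // => s s' e; apply/ffunP => i.
  by have /eq_in_map/(_ i) := e; rewrite mem_enum => /(_ isT) /val_inj.
apply: uniq_perm => //; first exact: words_uniq gnodes_uniq.
apply: (uniq_min_size us _ _).2.
  move=> vs /mapP[s _ ->].
  have : {subset [seq target s i | i <- enum 'I_m] <= gnodes t w}.
    by move=> v /mapP[i _ ->]; exact: ssvalP.
  by move/mem_words; rewrite size_map size_enum_ord.
rewrite size_words size_map -[index_enum _]enumT -cardE card_ffun card_ord.
by rewrite card_seq_sub ?gnodes_uniq.
Qed.

Lemma brec_grafting (k : fieldType) :
  brec k t w = \sum_(s : assignment t w | is_grafting s) << grafting s >>.
Proof.
have tE : t = map (@erase _) X0 :> seq tree.
  rewrite -map_comp -[LHS]map_tnth_enum; apply: eq_map => i /=.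
  by rewrite erase_annot.
have wE : w = erase w0 by rewrite erase_annot.
rewrite [in LHS]tE [X in brec _ _ X]wE (brec_lrun _ gnodes_uniq perm_gnodes).
have -> : size X0 = m by rewrite size_map size_enum_ord.
rewrite sum_words [RHS]big_mkcond; apply: eq_bigr => s _.
have [-> H] := lrun_grafting s.
by case E: (lrun _ _ _) => [L|] //=; rewrite -(H L).
Qed.

End GraftingSum.

Theorem proposition4p4 (k : closedFieldType) (char0 : [pchar k] =i pred0)
    (S : {linear kOF k -> kOF k}) (S_antipode : is_antipode S)
    (m : nat) (t : m.-tuple tree) (w : tree) :
  brhd S (FMonom t) (FMonom [:: w])
    = inT (\sum_(p : 'S_m) bracket k t w p)
  /\ \sum_(p : 'S_m) bracket k t w p
    = \sum_(s : assignment t w | is_grafting s) << grafting s >>.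
Proof.
by rewrite (brhd_brec t w S_antipode) sum_bracket; split=> //; apply: brec_grafting.
Qed.
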